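(* Let $X$ be a locally coherent scheme with structure sheaf $\mathcal{O}_X$, and let $\mathscr{P}_\bullet$ be a complex of possibly infinite dimensional vector bundles on $X$. If $\mathscr{P}_\bullet$ is $\mathbf{F}$-totally acyclic, then the complex $\mathscr{P}_\bullet(U)$ of projective $\mathcal{O}_X(U)$-modules is totally acyclic for every open affine subset $U\subseteq X$.
   Context: A scheme $X$ is locally coherent if for every open affine subset $U\subseteq X$ the ring $\mathcal{O}_X(U)$ is coherent. A (not necessarily finite dimensional) vector bundle on $X$ is a quasi-coherent sheaf $\mathscr{P}$ such that the $\mathcal{O}_X(U)$-module $\mathscr{P}(U)$ is projective for every open affine subset $U\subseteq X$. For a commutative ring $R$, a ($\mathbb{Z}$-indexed) complex $P_\bullet$ of projective $R$-modules is called totally acyclic if it is acyclic and $\operatorname{Hom}_R(P_\bullet,Q)$ is acyclic for every projective $R$-module $Q$. A complex $F_\bullet$ of flat $R$-modules is called $\mathbf{F}$-totally acyclic if it is acyclic and $I\otimes_R F_\bullet$ is acyclic for every injective $R$-module $I$. A complex $\mathscr{F}_\bullet$ of flat quasi-coherent sheaves on $X$ is called $\mathbf{F}$-totally acyclic if for every open affine subset $U\subseteq X$ the complex $\mathscr{F}_\bullet(U)$ of flat $\mathcal{O}_X(U)$-modules is $\mathbf{F}$-totally acyclic. *)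

(* Defs.v *)
From HB Require Import structures.
From mathcomp Require Import all_boot all_order all_algebra.
From mathcomp Require Import generic_quotient.
From mathcomp Require Import all_classical topology.
From mathcomp Require Import ring.

Set Implicit Arguments.
Unset Strict Implicit.
Unset Printing Implicit Defensive.

Import GRing.Theory.
Local Open Scope classical_set_scope.
Local Open Scope ring_scope.
Local Open Scope quotient_scope.

(** Rings are [comPzRingType]: the zero ring is allowed, since it occurs as
    the ring of sections over the empty open set. *)

Definition exact_pair (A B C : zmodType) (f : A -> B) (g : B -> C) : Prop :=
  forall b, g b = 0 <-> exists a, f a = b.

(** An element of [tensor M N] is the class of a list [(m1, n1); ...; (mk, nk)],
    standing for m1 ⊗ n1 + ... + mk ⊗ nk. *)

Section Tensor.
Variables (R : comPzRingType) (M N : lmodType R).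

Inductive tensor_rel : seq (M * N) -> seq (M * N) -> Prop :=
| tensor_refl s : tensor_rel s s
| tensor_sym s t : tensor_rel s t -> tensor_rel t s
| tensor_trans s t u : tensor_rel s t -> tensor_rel t u -> tensor_rel s u
| tensor_cat s s' t t' :
    tensor_rel s s' -> tensor_rel t t' -> tensor_rel (s ++ t) (s' ++ t')
| tensor_comm s t : tensor_rel (s ++ t) (t ++ s)
| tensor_0l n : tensor_rel [:: (0, n)] [::]
| tensor_Dl m m' n : tensor_rel [:: (m + m', n)] [:: (m, n); (m', n)]
| tensor_Dr m n n' : tensor_rel [:: (m, n + n')] [:: (m, n); (m, n')]
| tensor_Z a m n : tensor_rel [:: (a *: m, n)] [:: (m, a *: n)].

Definition tensor_eqb (s t : seq (M * N)) : bool := `[< tensor_rel s t >].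

Lemma tensor_eqb_refl : reflexive tensor_eqb.
Proof. by move=> s; apply/asboolP; apply: tensor_refl. Qed.

Lemma tensor_eqb_sym : symmetric tensor_eqb.
Proof. by move=> s t; apply/asboolP/asboolP; apply: tensor_sym. Qed.

Lemma tensor_eqb_trans : transitive tensor_eqb.
Proof.
by move=> t s u /asboolP st /asboolP tu; apply/asboolP; apply: tensor_trans tu.
Qed.

Canonical tensor_equiv :=
  EquivRel tensor_eqb tensor_eqb_refl tensor_eqb_sym tensor_eqb_trans.

Definition tensor := {eq_quot tensor_eqb}.
HB.instance Definition _ := Choice.on tensor.
HB.instance Definition _ := EqQuotient.on tensor.

Lemma tensor_eqP (s t : seq (M * N)) :
  \pi_tensor s = \pi_tensor t <-> tensor_rel s t.
Proof.
by split=> [/eqmodP/asboolP|st]; last by apply/eqmodP/asboolP.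
Qed.

Lemma tensorW (P : tensor -> Prop) :
  (forall s, P (\pi_tensor s)) -> forall x, P x.
Proof. by move=> piP x; rewrite -[x]reprK. Qed.

Lemma tensor_reprP (s : seq (M * N)) : tensor_rel (repr (\pi_tensor s)) s.
Proof. by apply/tensor_eqP; rewrite reprK. Qed.

Let oppp (x : M * N) := (- x.1, x.2).
Let scalep (a : R) (x : M * N) := (a *: x.1, x.2).

Lemma tensor_rel_scale a s t :
  tensor_rel s t -> tensor_rel (map (scalep a) s) (map (scalep a) t).
Proof.
elim=> {s t} [s|s t _ st|s t u _ st _ tu|s s' t t' _ st _ tu|s t|n|m m' n|m n n'
  |b m n] /=.
- exact: tensor_refl.
- exact: tensor_sym.
- exact: tensor_trans tu.
- by rewrite !map_cat; apply: tensor_cat.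
- by rewrite !map_cat; apply: tensor_comm.
- by rewrite /scalep /= scaler0; apply: tensor_0l.
- by rewrite /scalep /= scalerDr; apply: tensor_Dl.
- exact: tensor_Dr.
- by rewrite /scalep /= scalerA mulrC -scalerA; apply: tensor_Z.
Qed.

Definition tensor_zero : tensor := \pi_tensor [::].
Definition tensor_add (x y : tensor) : tensor := \pi_tensor (repr x ++ repr y).
Definition tensor_scale (a : R) (x : tensor) : tensor :=
  \pi_tensor (map (scalep a) (repr x)).
Definition tensor_opp (x : tensor) : tensor := tensor_scale (-1) x.

Lemma tensor_addE s t :
  tensor_add (\pi_tensor s) (\pi_tensor t) = \pi_tensor (s ++ t).
Proof. by apply/tensor_eqP/tensor_cat; apply: tensor_reprP. Qed.

Lemma tensor_scaleE a s :
  tensor_scale a (\pi_tensor s) = \pi_tensor (map (scalep a) s).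
Proof. by apply/tensor_eqP/tensor_rel_scale/tensor_reprP. Qed.

Lemma tensor_addA : associative tensor_add.
Proof.
elim/tensorW=> s; elim/tensorW=> t; elim/tensorW=> u.
by rewrite !tensor_addE catA.
Qed.

Lemma tensor_addC : commutative tensor_add.
Proof.
elim/tensorW=> s; elim/tensorW=> t; rewrite !tensor_addE.
exact/tensor_eqP/tensor_comm.
Qed.

Lemma tensor_add0 : left_id tensor_zero tensor_add.
Proof. by elim/tensorW=> s; rewrite tensor_addE. Qed.

Lemma tensor_scaleDl (x : tensor) a b :
  tensor_scale (a + b) x = tensor_add (tensor_scale a x) (tensor_scale b x).
Proof.
elim/tensorW: x => s; rewrite !tensor_scaleE tensor_addE; apply/tensor_eqP.
elim: s => [|[m n] s IHs] /=; first exact: tensor_refl.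
rewrite -cat1s /scalep /= scalerDl.
apply: tensor_trans (tensor_cat (tensor_Dl _ _ _) IHs) _.
rewrite -[X in tensor_rel _ X]cat1s -[[:: _; _]]cat1s -!catA.
apply: tensor_cat; first exact: tensor_refl.
rewrite catA -[X in tensor_rel _ (_ ++ X)]cat1s [X in tensor_rel _ X]catA.
by apply: tensor_cat; [apply: tensor_comm | apply: tensor_refl].
Qed.

Lemma tensor_scale0 (x : tensor) : tensor_scale 0 x = tensor_zero.
Proof.
elim/tensorW: x => s; rewrite tensor_scaleE; apply/tensor_eqP.
elim: s => [|[m n] s IHs] /=; first exact: tensor_refl.
rewrite -cat1s /scalep /= scale0r.
exact: tensor_cat (tensor_0l n) IHs.
Qed.

Lemma tensor_scale1 : left_id 1 tensor_scale.
Proof.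
elim/tensorW=> s; rewrite tensor_scaleE; congr (\pi_tensor _).
by apply: map_id_in => -[m n] _; rewrite /scalep /= scale1r.
Qed.

Lemma tensor_addN : left_inverse tensor_zero tensor_opp tensor_add.
Proof.
move=> x; rewrite -{2}[x]tensor_scale1 /tensor_opp -tensor_scaleDl.
by rewrite addNr tensor_scale0.
Qed.

HB.instance Definition _ := GRing.isZmodule.Build tensor
  tensor_addA tensor_addC tensor_add0 tensor_addN.

Lemma tensor_scaleA a b (x : tensor) :
  tensor_scale a (tensor_scale b x) = tensor_scale (a * b) x.
Proof.
elim/tensorW: x => s; rewrite !tensor_scaleE -map_comp; congr (\pi_tensor _).
by apply: eq_map => -[m n]; rewrite /= /scalep /= scalerA.
Qed.

Lemma tensor_scaleDr : right_distributive tensor_scale +%R.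
Proof.
move=> a; elim/tensorW=> s; elim/tensorW=> t.
rewrite [X in tensor_scale _ X]tensor_addE !tensor_scaleE.
by rewrite [RHS]tensor_addE map_cat.
Qed.

HB.instance Definition _ := GRing.Zmodule_isLmodule.Build R tensor
  tensor_scaleA tensor_scale1 tensor_scaleDr tensor_scaleDl.

Definition tens (m : M) (n : N) : tensor := \pi_tensor [:: (m, n)].

Lemma tensDl m m' n : tens (m + m') n = tens m n + tens m' n.
Proof. by rewrite [RHS]tensor_addE; apply/tensor_eqP/tensor_Dl. Qed.

Lemma tensDr m n n' : tens m (n + n') = tens m n + tens m n'.
Proof. by rewrite [RHS]tensor_addE; apply/tensor_eqP/tensor_Dr. Qed.

Lemma tensZl a m n : tens (a *: m) n = a *: tens m n.
Proof. by rewrite [RHS]tensor_scaleE. Qed.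

Lemma tensZr a m n : tens m (a *: n) = a *: tens m n.
Proof. by rewrite -tensZl; apply/tensor_eqP/tensor_sym/tensor_Z. Qed.

Lemma tensor_piE s : \pi_tensor s = \sum_(x <- s) tens x.1 x.2.
Proof.
elim: s => [|[m n] s IHs]; first by rewrite big_nil.
by rewrite big_cons -IHs [RHS]tensor_addE.
Qed.

Lemma tensor_universal (W : lmodType R) (b : M -> N -> W) :
    (forall m m' n, b (m + m') n = b m n + b m' n) ->
    (forall m n n', b m (n + n') = b m n + b m n') ->
    (forall a m n, b (a *: m) n = a *: b m n) ->
    (forall a m n, b m (a *: n) = a *: b m n) ->
  exists f : {linear tensor -> W},
    (forall m n, f (tens m n) = b m n) /\
    (forall g : {linear tensor -> W},
      (forall m n, g (tens m n) = b m n) -> g =1 f).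
Proof.
move=> bDl bDr bZl bZr; pose ev (s : seq (M * N)) := \sum_(x <- s) b x.1 x.2.
have evP s t : tensor_rel s t -> ev s = ev t.
  rewrite /ev; elim=> {s t} [s|s t _ ->|s t u _ -> _ ->|s s' t t' _ ss _ tt|s t|n
    |m m' n|m n n'|a m n] //; rewrite ?big_cat /= ?ss ?tt //.
  - by rewrite addrC.
  - by rewrite big_seq1 big_nil /= -(scale0r (0 : M)) bZl scale0r.
  - by rewrite !(big_cons, big_nil) /= !addr0 bDl.
  - by rewrite !(big_cons, big_nil) /= !addr0 bDr.
  - by rewrite !big_seq1 /= bZl bZr.
pose f (x : tensor) := ev (repr x).
have fE s : f (\pi_tensor s) = ev s by apply/evP/tensor_reprP.
have f_lin : linear f.
  move=> a; elim/tensorW=> s; elim/tensorW=> t.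
  rewrite [a *: _]tensor_scaleE [_ + _]tensor_addE !fE /ev big_cat big_map.
  by rewrite scaler_sumr; congr (_ + _); apply: eq_bigr => x _; rewrite bZl.
pose fL := GRing.isLinear.Build R tensor W *:%R f f_lin.
pose F : {linear tensor -> W} := HB.pack f fL.
exists F; split=> [m n|g gE]; first by rewrite /= fE /ev big_seq1.
elim/tensorW=> s /=.
by rewrite fE tensor_piE /= raddf_sum; apply: eq_bigr => x _; exact: gE.
Qed.

End Tensor.

Section TensorMap.
Variables (R : comPzRingType) (M N N' : lmodType R) (f : {linear N -> N'}).

Definition tensor_map (x : tensor M N) : tensor M N' :=
  \pi_(tensor M N') [seq (y.1, f y.2) | y <- repr x].

Lemma tensor_map_rel s t : tensor_rel s t ->
  tensor_rel [seq ((y : M * N).1, f y.2) | y <- s] [seq (y.1, f y.2) | y <- t].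
Proof.
elim=> {s t} [s|s t _ st|s t u _ st _ tu|s s' t t' _ st _ tu|s t|n|m m' n|m n n'
  |b m n] /=.
- exact: tensor_refl.
- exact: tensor_sym.
- exact: tensor_trans tu.
- by rewrite !map_cat; apply: tensor_cat.
- by rewrite !map_cat; apply: tensor_comm.
- exact: tensor_0l.
- exact: tensor_Dl.
- by rewrite raddfD; apply: tensor_Dr.
- by rewrite linearZ; apply: tensor_Z.
Qed.

Lemma tensor_map_pi s : tensor_map (\pi_(tensor M N) s) =
  \pi_(tensor M N') [seq (y.1, f y.2) | y <- s].
Proof. by apply/tensor_eqP/tensor_map_rel/tensor_reprP. Qed.

Lemma tensor_mapE m n : tensor_map (tens m n) = tens m (f n).
Proof. by rewrite /tens tensor_map_pi. Qed.

Lemma tensor_map_linear : linear tensor_map.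
Proof.
move=> a; elim/tensorW=> s; elim/tensorW=> t.
rewrite [X in tensor_map (X + _)]tensor_scaleE [X in tensor_map X]tensor_addE.
rewrite !tensor_map_pi [X in _ = X + _]tensor_scaleE [RHS]tensor_addE.
by rewrite map_cat -!map_comp.
Qed.

HB.instance Definition _ :=
  GRing.isLinear.Build R (tensor M N) (tensor M N') *:%R tensor_map
    tensor_map_linear.

End TensorMap.

Section ModuleNotions.
Variable R : comPzRingType.

Definition projective (P : lmodType R) : Prop :=
  forall (M N : lmodType R) (g : {linear M -> N}) (f : {linear P -> N}),
    (forall y, exists x, g x = y) ->
    exists h : {linear P -> M}, forall x, g (h x) = f x.

Definition injective_module (I : lmodType R) : Prop :=
  forall (M N : lmodType R) (g : {linear M -> N}) (f : {linear M -> I}),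
    injective g ->
    exists h : {linear N -> I}, forall x, h (g x) = f x.

Definition flat (F : lmodType R) : Prop :=
  forall (A B C : lmodType R) (f : {linear A -> B}) (g : {linear B -> C}),
    exact_pair f g ->
    exact_pair (@tensor_map R F _ _ f) (@tensor_map R F _ _ g).

Definition finitely_generated (M : lmodType R) (S : set M) : Prop :=
  exists (n : nat) (g : 'I_n -> M),
    S = [set x | exists c : 'I_n -> R, x = \sum_(i < n) c i *: g i].

(** [f] and finitely many generators of its kernel give an exact sequence
    [R^m -> R^n -> S -> 0]. *)
Definition finitely_presented (M : lmodType R) (S : set M) : Prop :=
  exists (n : nat) (f : {linear 'rV[R]_n -> M}),
    range f = S /\ finitely_generated [set v | f v = 0].

(** Finitely generated subsets of [R^o] are exactly finitely generated ideals. *)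
Definition coherent_ring : Prop :=
  forall I : set R^o, finitely_generated I -> finitely_presented I.

(** Homological indexing; [cx_d n] is the differential from degree [n + 1] to
    degree [n], which avoids transports along [n - 1 + 1 = n]. *)
Record complex := Complex {
  cx_obj :> int -> lmodType R;
  cx_d : forall n : int, {linear cx_obj (n + 1) -> cx_obj n};
  cx_dd : forall (n : int) x, cx_d n (cx_d (n + 1) x) = 0
}.

(** Exactness at the object of degree [n + 1], for every integer [n]. *)
Definition acyclic (C : complex) : Prop :=
  forall n : int, exact_pair (cx_d C (n + 1)) (cx_d C n).

Lemma tensor_complex_dd (I : lmodType R) (C : complex) (n : int)
    (x : tensor I (C (n + 1 + 1))) :
  tensor_map (cx_d C n) (tensor_map (cx_d C (n + 1)) x) = 0.
Proof.
elim/tensorW: x => s; rewrite tensor_piE !raddf_sum big1 // => -[m y] _ /=.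
by rewrite !tensor_mapE /= cx_dd -(scale0r 0) tensZr scale0r.
Qed.

Definition tensor_complex (I : lmodType R) (C : complex) : complex :=
  Complex (@tensor_complex_dd I C).

(** Exactness of the complex [Hom(C, Q)] at [Hom(C (n + 1), Q)], for every
    integer [n]. *)
Definition Hom_acyclic (C : complex) (Q : lmodType R) : Prop :=
  forall (n : int) (f : {linear C (n + 1) -> Q}),
    (forall x, f (cx_d C (n + 1) x) = 0) <->
    (exists g : {linear C n -> Q}, forall x, g (cx_d C n x) = f x).

Definition totally_acyclic (C : complex) : Prop :=
  [/\ forall n, projective (C n),
      acyclic C &
      forall Q : lmodType R, projective Q -> Hom_acyclic C Q].

Definition F_totally_acyclic (C : complex) : Prop :=
  [/\ forall n, flat (C n),
      acyclic C &
      forall I : lmodType R, injective_module I -> acyclic (tensor_complex I C)].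

End ModuleNotions.

Record opens (X : topologicalType) := Opens {
  opens_set :> set X;
  opens_open : open opens_set
}.

Definition opensI (X : topologicalType) (U V : opens X) : opens X :=
  Opens (openI (opens_open U) (opens_open V)).

Lemma opensIl (X : topologicalType) (U V : opens X) : opensI U V `<=` U.
Proof. exact: subIsetl. Qed.

Lemma opensIr (X : topologicalType) (U V : opens X) : opensI U V `<=` V.
Proof. exact: subIsetr. Qed.

Definition sheaf_condition (X : topologicalType) (F : opens X -> Type)
    (res : forall U V : opens X, V `<=` U -> F U -> F V) : Prop :=
  forall (I : Type) (U : opens X) (V : I -> opens X)
      (VU : forall i, V i `<=` U),
    U `<=` \bigcup_i V i ->
    forall s : forall i, F (V i),
      (forall i j, res _ _ (@opensIl X (V i) (V j)) (s i)
                 = res _ _ (@opensIr X (V i) (V j)) (s j)) ->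
    exists! t : F U, forall i, res U (V i) (VU i) t = s i.

Record ringed_space := RingedSpace {
  rs_top :> topologicalType;
  rs_O : opens rs_top -> comPzRingType;
  rs_res : forall U V : opens rs_top, V `<=` U -> {rmorphism rs_O U -> rs_O V};
  rs_res_id : forall (U : opens rs_top) (h : U `<=` U) s, rs_res h s = s;
  rs_res_comp : forall (U V W : opens rs_top)
      (h : V `<=` U) (k : W `<=` V) (l : W `<=` U) s,
    rs_res k (rs_res h s) = rs_res l s;
  rs_sheaf : sheaf_condition (fun U V (h : V `<=` U) => rs_res h : _ -> _)
}.

Record omodule (X : ringed_space) := OModule {
  om_sec :> forall U : opens X, lmodType (rs_O U);
  om_res : forall U V : opens X, V `<=` U -> {additive om_sec U -> om_sec V};
  om_resZ : forall (U V : opens X) (h : V `<=` U) (a : rs_O U) (s : om_sec U),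
    om_res h (a *: s) = rs_res h a *: om_res h s;
  om_res_id : forall (U : opens X) (h : U `<=` U) s, om_res h s = s;
  om_res_comp : forall (U V W : opens X)
      (h : V `<=` U) (k : W `<=` V) (l : W `<=` U) s,
    om_res k (om_res h s) = om_res l s;
  om_sheaf : sheaf_condition (fun U V (h : V `<=` U) => om_res h : _ -> _)
}.

Record omodule_hom (X : ringed_space) (F G : omodule X) := OModuleHom {
  oh_map :> forall U : opens X, {linear F U -> G U};
  oh_res : forall (U V : opens X) (h : V `<=` U) (s : F U),
    om_res G h (oh_map U s) = oh_map V (om_res F h s)
}.

Section OpenSubspace.
Variables (X : ringed_space) (U : opens X).

Local Notation S := (set_type (opens_set U)).

Lemma push_open_subproof (W : opens S) : open (set_val @` W).
Proof.
have [O Oop OW] := opens_open W; rewrite -OW.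
suff -> : set_val @` (set_val @^-1` O : set S) = O `&` U.
  exact: openI Oop (opens_open U).
apply/seteqP; split=> [_ [x Ox <-]|x [Ox Ux]]; first by split=> //; exact: set_valP.
by exists (SigSub (mem_set Ux)).
Qed.

Definition push_open (W : opens S) : opens X := Opens (push_open_subproof W).

Lemma push_openS (V W : opens S) : W `<=` V -> push_open W `<=` push_open V.
Proof. exact: image_subset. Qed.

Lemma push_openI (V W : opens S) :
  opensI (push_open V) (push_open W) `<=` push_open (opensI V W).
Proof.
move=> x [[v Vv vx] [w Ww wx]].
by exists v => //; split=> //; suff -> : v = w by []; apply/val_inj/(etrans vx (esym wx)).
Qed.

Lemma push_sheaf (F : opens X -> Type)
    (res : forall U V : opens X, V `<=` U -> F U -> F V) :
    (forall (U V W : opens X) (h : V `<=` U) (k : W `<=` V) (l : W `<=` U) s,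
       res _ _ k (res _ _ h s) = res _ _ l s) ->
    sheaf_condition res ->
  sheaf_condition (F := fun W => F (push_open W))
    (fun V W (h : W `<=` V) => res _ _ (push_openS h)).
Proof.
move=> resM Fsh I V W WV Vcov s sP.
apply: (Fsh I (push_open V) (fun i => push_open (W i))) => [|i j].
  by move=> _ [v /Vcov[i _ Wv] <-]; exists i => //; exists v.
have /(congr1 (res _ _ (@push_openI (W i) (W j)))) := sP i j.
by rewrite !(resM _ _ _ _ _ (@opensIl _ _ _)) !(resM _ _ _ _ _ (@opensIr _ _ _)).
Qed.

Definition restrict_space : ringed_space.
Proof.
refine (@RingedSpace S (fun W => rs_O (push_open W))
  (fun V W h => rs_res (push_openS h)) _ _ _).
- by move=> V h s; apply: rs_res_id.
- by move=> V W T h k l s; apply: rs_res_comp.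
- exact: push_sheaf (@rs_res_comp X) (@rs_sheaf X).
Defined.

Definition restrict_module (F : omodule X) : omodule restrict_space.
Proof.
refine (@OModule restrict_space (fun W => F (push_open W))
  (fun V W h => om_res F (push_openS h)) _ _ _ _).
- by move=> V W h a s; apply: om_resZ.
- by move=> V h s; apply: om_res_id.
- by move=> V W T h k l s; apply: om_res_comp.
- exact: push_sheaf (@om_res_comp X F) (@om_sheaf X F).
Defined.

End OpenSubspace.

Definition opens_preim (X Y : topologicalType) (f : X -> Y)
    (fC : continuous f) (V : opens Y) : opens X :=
  Opens ((continuousP f).1 fC V (opens_open V)).

Lemma opens_preimS (X Y : topologicalType) (f : X -> Y) (fC : continuous f)
  (V W : opens Y) : W `<=` V -> opens_preim fC W `<=` opens_preim fC V.
Proof. exact: preimage_subset. Qed.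

Record ringed_iso (X Y : ringed_space) := RingedIso {
  ri_fun : X -> Y;
  ri_inv : Y -> X;
  ri_funK : cancel ri_fun ri_inv;
  ri_invK : cancel ri_inv ri_fun;
  ri_continuous : continuous ri_fun;
  ri_inv_continuous : continuous ri_inv;
  ri_sharp : forall V : opens Y,
    {rmorphism rs_O V -> rs_O (opens_preim ri_continuous V)};
  ri_sharp_bij : forall V, bijective (ri_sharp V);
  ri_sharp_res : forall (V W : opens Y) (h : W `<=` V) s,
    rs_res (opens_preimS (fC := ri_continuous) h) (ri_sharp V s)
    = ri_sharp W (rs_res h s)
}.

Arguments ri_continuous {X Y} r.

(** [F] corresponds to [G] when [X] and [Y] are identified along [phi]. *)
Record omodule_iso (X Y : ringed_space) (phi : ringed_iso X Y)
    (F : omodule X) (G : omodule Y) := OModuleIso {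
  oi_map : forall V : opens Y,
    {additive G V -> F (opens_preim (ri_continuous phi) V)};
  oi_mapZ : forall (V : opens Y) (a : rs_O V) (s : G V),
    oi_map V (a *: s) = ri_sharp phi V a *: oi_map V s;
  oi_map_bij : forall V, bijective (oi_map V);
  oi_map_res : forall (V W : opens Y) (h : W `<=` V) s,
    om_res F (opens_preimS (fC := ri_continuous phi) h) (oi_map V s)
    = oi_map W (om_res G h s)
}.

Record spec (A : comPzRingType) := PrimeIdeal {
  prime_set :> set A;
  prime0 : prime_set 0;
  primeD : forall a b, prime_set a -> prime_set b -> prime_set (a + b);
  primeM : forall a b, prime_set b -> prime_set (a * b);
  prime1 : ~ prime_set 1;
  prime_or : forall a b, prime_set (a * b) -> prime_set a \/ prime_set b
}.

Section Zariski.
Variable A : comPzRingType.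

HB.instance Definition _ := gen_eqMixin (spec A).
HB.instance Definition _ := gen_choiceMixin (spec A).

Definition zariski_closed (E : set A) : set (spec A) := [set p | E `<=` p].
Definition zariski_open (U : set (spec A)) : Prop :=
  exists E : set A, U = ~` zariski_closed E.

Lemma zariski_openT : zariski_open setT.
Proof.
exists setT; apply/seteqP; split=> // p _ sp; exact: (prime1 (sp 1 I)).
Qed.

Lemma zariski_openI : setI_closed zariski_open.
Proof.
move=> _ _ [E ->] [F ->]; exists [set a | exists2 e, E e & exists2 f, F f & a = e * f].
apply/seteqP; split=> [p [nE nF] sEF|p nEF].
  have /existsNP[e /not_implyP[Ee pe]] := nE.
  have /existsNP[f /not_implyP[Ff pf]] := nF.
  by case: (prime_or (sEF (e * f) _)) => //; exists e => //; exists f.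
split=> s; apply: nEF => _ [e Ee [f Ff ->]].
  by rewrite mulrC; apply: primeM; apply: s.
by apply: primeM; apply: s.
Qed.

Lemma zariski_open_bigU (I : Type) (f : I -> set (spec A)) :
  (forall i, zariski_open (f i)) -> zariski_open (\bigcup_i f i).
Proof.
move=> /choice[E fE]; exists (\bigcup_i E i).
apply/seteqP; split=> [p [i _]|p np].
  by rewrite fE => np sE; apply: np => a Ea; apply: sE; exists i.
apply: contrapT => nf; apply: np => a [i _ Ea].
apply: contrapT => npa; apply: nf; exists i => //; rewrite fE => sE.
exact/npa/sE.
Qed.

HB.instance Definition _ := isOpenTopological.Build (spec A)
  zariski_openT zariski_openI zariski_open_bigU.

End Zariski.

(** [loc M p] is the set of fractions m/s with m in [M] and s not in [p].  The
    local ring is [loc A^o p], and its multiplication is the case [M = A^o] of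
    its action [loc_act] on [loc M p]. *)

Section Localization.
Variables (A : comPzRingType) (M : lmodType A) (p : spec A).

Definition denom := set_type (~` (p : set A)).

Lemma denom_neg (s : denom) : ~ prime_set p (sval s).
Proof. exact: set_valP s. Qed.

Lemma denomM_subproof (s t : denom) : sval s * sval t \in ~` (p : set A).
Proof. by apply/mem_set => /prime_or[] /denom_neg. Qed.

Definition denomM (s t : denom) : denom := SigSub (denomM_subproof s t).
Lemma denom1_subproof : 1 \in ~` (p : set A).
Proof. exact/mem_set/prime1. Qed.

Definition denom1 : denom := SigSub denom1_subproof.

Definition loc_eqb (x y : M * denom) : bool :=
  `[< exists u : denom, sval u *: (sval y.2 *: x.1) = sval u *: (sval x.2 *: y.1) >].

Lemma loc_eqb_refl : reflexive loc_eqb.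
Proof. by move=> x; apply/asboolP; exists denom1. Qed.

Lemma loc_eqb_sym : symmetric loc_eqb.
Proof. by move=> x y; apply/asboolP/asboolP => -[u xy]; exists u. Qed.

Lemma loc_eqb_trans : transitive loc_eqb.
Proof.
move=> [n t] [m s] [o r] /asboolP[u /= mn] /asboolP[v /= no]; apply/asboolP.
exists (denomM (denomM u v) t) => /=; move: mn no; rewrite !scalerA => mn no.
have -> : sval u * sval v * sval t * sval r = (sval v * sval r) * (sval u * sval t).
  by ring.
rewrite -scalerA mn scalerA.
have -> : sval v * sval r * (sval u * sval s) = (sval u * sval s) * (sval v * sval r).
  by ring.
rewrite -scalerA no scalerA; congr (_ *: _).
by ring.
Qed.

Canonical loc_equiv := EquivRel loc_eqb loc_eqb_refl loc_eqb_sym loc_eqb_trans.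

Definition loc := {eq_quot loc_eqb}.
HB.instance Definition _ := Choice.on loc.
HB.instance Definition _ := EqQuotient.on loc.

Definition frac (m : M) (s : denom) : loc := \pi_loc (m, s).

Lemma frac_eqP m s n t : frac m s = frac n t <->
  exists u : denom, sval u *: (sval t *: m) = sval u *: (sval s *: n).
Proof. by split=> [/eqmodP/asboolP|st]; last by apply/eqmodP/asboolP. Qed.

Lemma frac_eq1 m s n t : sval t *: m = sval s *: n -> frac m s = frac n t.
Proof. by move=> mn; apply/frac_eqP; exists denom1; rewrite mn. Qed.

Lemma locW (P : loc -> Prop) : (forall m s, P (frac m s)) -> forall x, P x.
Proof. by move=> fP x; rewrite -[x]reprK; case: (repr x) => m s; apply: fP. Qed.

Definition loc_zero : loc := frac 0 denom1.
Definition loc_add (x y : loc) : loc :=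
  let: (m, s) := repr x in let: (n, t) := repr y in
  frac (sval t *: m + sval s *: n) (denomM s t).
Definition loc_opp (x : loc) : loc := let: (m, s) := repr x in frac (- m) s.

Lemma loc_addE m s n t : loc_add (frac m s) (frac n t) =
  frac (sval t *: m + sval s *: n) (denomM s t).
Proof.
rewrite /loc_add.
have := reprK (frac m s); case: (repr _) => m' s' /frac_eqP[u].
have := reprK (frac n t); case: (repr _) => n' t' /frac_eqP[v].
rewrite !scalerA => ntE msE; apply/frac_eqP; exists (denomM u v) => /=.
rewrite !scalerDr !scalerA; congr (_ + _).
  have -> : sval u * sval v * (sval s * sval t) * sval t' =
    (sval v * sval t * sval t') * (sval u * sval s) by ring.
  by rewrite -scalerA msE scalerA; congr (_ *: _); ring.
have -> : sval u * sval v * (sval s * sval t) * sval s' =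
  (sval u * sval s * sval s') * (sval v * sval t) by ring.
by rewrite -scalerA ntE scalerA; congr (_ *: _); ring.
Qed.

Lemma loc_oppE m s : loc_opp (frac m s) = frac (- m) s.
Proof.
rewrite /loc_opp; have := reprK (frac m s); case: (repr _) => m' s' /frac_eqP[u].
by move=> E; apply/frac_eqP; exists u; rewrite !scalerN E.
Qed.

Lemma loc_addA : associative loc_add.
Proof.
elim/locW=> m s; elim/locW=> n t; elim/locW=> o r; rewrite !loc_addE.
apply: frac_eq1 => /=; rewrite !scalerDr !scalerA addrA.
by congr (_ *: _ + _ *: _ + _ *: _); ring.
Qed.

Lemma loc_addC : commutative loc_add.
Proof.
elim/locW=> m s; elim/locW=> n t; rewrite !loc_addE.
apply: frac_eq1 => /=; rewrite !scalerDr !scalerA addrC.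
by congr (_ *: _ + _ *: _); ring.
Qed.

Lemma loc_add0 : left_id loc_zero loc_add.
Proof.
elim/locW=> m s; rewrite loc_addE; apply: frac_eq1 => /=.
by rewrite scaler0 add0r scale1r mul1r.
Qed.

Lemma loc_addN : left_inverse loc_zero loc_opp loc_add.
Proof.
elim/locW=> m s; rewrite loc_oppE loc_addE; apply: frac_eq1 => /=.
by rewrite scalerN addNr !scaler0.
Qed.

HB.instance Definition _ := GRing.isZmodule.Build loc
  loc_addA loc_addC loc_add0 loc_addN.

End Localization.

Section LocalizationAction.
Variables (A : comPzRingType) (p : spec A).

Section Action.
Variable M : lmodType A.

Definition loc_act (x : loc A^o p) (y : loc M p) : loc M p :=
  let: (a, s) := repr x in let: (m, t) := repr y in
  frac ((a : A) *: m) (denomM s t).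

Lemma loc_actE (a : A) s m t :
  loc_act (frac (a : A^o) s) (frac m t) = frac (a *: m) (denomM s t).
Proof.
rewrite /loc_act.
have := reprK (frac (a : A^o) s); case: (repr _) => a' s' /frac_eqP[u].
have := reprK (frac m t); case: (repr _) => m' t' /frac_eqP[v].
rewrite !scalerA => mtE asE; apply/frac_eqP; exists (denomM u v) => /=.
rewrite !scalerA.
have -> : sval u * sval v * (sval s * sval t) * a' =
  (sval u * sval s * a') * (sval v * sval t) by ring.
rewrite -scalerA mtE scalerA; congr (_ *: _).
have -> : sval u * sval s * a' = sval u * sval s' * a by exact: asE.
by ring.
Qed.

Lemma loc_actDr x y z : loc_act x (y + z) = loc_act x y + loc_act x z.
Proof.
elim/locW: x => a s; elim/locW: y => m t; elim/locW: z => n r.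
rewrite [X in loc_act _ X]loc_addE !loc_actE [RHS]loc_addE.
apply: frac_eq1 => /=; rewrite !(scalerDr, scalerA).
by congr (_ *: _ + _ *: _); ring.
Qed.

Lemma loc_actDl x y z : loc_act (x + y) z = loc_act x z + loc_act y z.
Proof.
elim/locW: x => a s; elim/locW: y => b t; elim/locW: z => m r.
rewrite [X in loc_act X _]loc_addE !loc_actE [RHS]loc_addE.
apply: frac_eq1 => /=; rewrite !(scalerDr, scalerA) -scalerDl; congr (_ *: _).
by rewrite /GRing.scale /=; ring.
Qed.

Lemma loc_act1 x : loc_act (frac (1 : A^o) (denom1 p)) x = x.
Proof.
elim/locW: x => m s; rewrite loc_actE; apply: frac_eq1 => /=.
by rewrite !scalerA; congr (_ *: _); ring.
Qed.

End Action.

Lemma loc_actA (M : lmodType A) (x y : loc A^o p) (z : loc M p) :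
  loc_act x (loc_act y z) = loc_act (loc_act x y) z.
Proof.
elim/locW: x => a s; elim/locW: y => b t; elim/locW: z => m r.
rewrite !loc_actE; apply: frac_eq1 => /=.
by rewrite !scalerA; congr (_ *: _); rewrite /GRing.scale /=; ring.
Qed.

Lemma loc_actC (x y : loc A^o p) : loc_act x y = loc_act y x.
Proof.
elim/locW: x => a s; elim/locW: y => b t; rewrite !loc_actE.
by apply: frac_eq1; rewrite /GRing.scale /=; ring.
Qed.

End LocalizationAction.

(** A section of [M~] over [V] is a family of fractions indexed by the points
    of [V] that is locally of the form m/f. *)

Section Tilde.
Variables (A : comPzRingType) (M : lmodType A).

Definition locally_fraction (V : opens (spec A))
    (s : forall p : set_type V, loc M (val p)) : Prop :=
  forall p : set_type V, exists2 W : opens (spec A), opens_set W (val p) &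
    exists (m : M) (f : A), forall q : set_type V,
      opens_set W (val q) ->
      exists fq : f \in ~` (prime_set (val q)), s q = frac m (SigSub fq).

Record tilde_sec (V : opens (spec A)) := TildeSec {
  ts_fun :> forall p : set_type V, loc M (val p);
  ts_loc : locally_fraction ts_fun
}.

Lemma tilde_secP V (s t : tilde_sec V) : (forall p, s p = t p) -> s = t.
Proof.
case: s t => [s sl] [t tl] /= st; have {}st := functional_extensionality_dep st.
by case: _ / st in tl *; congr TildeSec; apply: Prop_irrelevance.
Qed.

HB.instance Definition _ V := gen_eqMixin (tilde_sec V).
HB.instance Definition _ V := gen_choiceMixin (tilde_sec V).

Variable V : opens (spec A).

Lemma tilde_zero_loc : @locally_fraction V (fun p => 0).
Proof.
move=> p; exists V; first exact: set_valP p.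
by exists 0, 1 => q _; exists (denom1_subproof (val q)).
Qed.

Lemma tilde_opp_loc (s : tilde_sec V) : @locally_fraction V (fun p => - s p).
Proof.
move=> p; have [W Wp [m [f sE]]] := ts_loc s p; exists W => //.
exists (- m), f => q /sE[fq ->]; exists fq; exact: loc_oppE.
Qed.

Lemma tilde_add_loc (s t : tilde_sec V) :
  @locally_fraction V (fun p => s p + t p).
Proof.
move=> p; have [W Wp [m [f sE]]] := ts_loc s p.
have [W' Wp' [n [g tE]]] := ts_loc t p; exists (opensI W W') => //.
exists (g *: m + f *: n), (f * g) => q [/sE[fq ->] /tE[gq ->]].
by exists (denomM_subproof (SigSub fq) (SigSub gq)); rewrite [LHS]loc_addE.
Qed.

Definition tilde_zero := TildeSec tilde_zero_loc.
Definition tilde_opp s := TildeSec (tilde_opp_loc s).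
Definition tilde_add s t := TildeSec (tilde_add_loc s t).

Lemma tilde_addA : associative tilde_add.
Proof. by move=> s t u; apply: tilde_secP => p; apply: addrA. Qed.
Lemma tilde_addC : commutative tilde_add.
Proof. by move=> s t; apply: tilde_secP => p; apply: addrC. Qed.
Lemma tilde_add0 : left_id tilde_zero tilde_add.
Proof. by move=> s; apply: tilde_secP => p; apply: add0r. Qed.
Lemma tilde_addN : left_inverse tilde_zero tilde_opp tilde_add.
Proof. by move=> s; apply: tilde_secP => p; apply: addNr. Qed.

HB.instance Definition _ := GRing.isZmodule.Build (tilde_sec V)
  tilde_addA tilde_addC tilde_add0 tilde_addN.

End Tilde.

Section TildeAction.
Variables (A : comPzRingType) (M : lmodType A) (V : opens (spec A)).

Lemma tilde_act_loc (a : tilde_sec A^o V) (s : tilde_sec M V) :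
  locally_fraction (fun p : set_type V => loc_act (a p) (s p)).
Proof.
move=> p; have [W Wp [b [f aE]]] := ts_loc a p.
have [W' Wp' [m [g sE]]] := ts_loc s p; exists (opensI W W') => //.
exists ((b : A) *: m), (f * g) => q [/aE[fq ->] /sE[gq ->]].
by exists (denomM_subproof (SigSub fq) (SigSub gq)); rewrite [LHS]loc_actE.
Qed.

Definition tilde_act a s := TildeSec (tilde_act_loc a s).

End TildeAction.

Section StructureSheaf.
Variables (A : comPzRingType) (V : opens (spec A)).

Definition spec_sec := tilde_sec A^o V.
HB.instance Definition _ := GRing.Zmodule.on spec_sec.

Lemma spec_one_loc :
  locally_fraction (fun p : set_type V => frac (1 : A^o) (denom1 (val p))).
Proof.
move=> p; exists V; first exact: set_valP p.
by exists 1, 1 => q _; exists (denom1_subproof (val q)).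
Qed.

Definition spec_one : spec_sec := TildeSec spec_one_loc.
Definition spec_mul (s t : spec_sec) : spec_sec := tilde_act s t.

Lemma spec_mulA : associative spec_mul.
Proof. by move=> s t u; apply: tilde_secP => p; apply: loc_actA. Qed.
Lemma spec_mulC : commutative spec_mul.
Proof. by move=> s t; apply: tilde_secP => p; apply: loc_actC. Qed.
Lemma spec_mul1 : left_id spec_one spec_mul.
Proof. by move=> s; apply: tilde_secP => p; apply: loc_act1. Qed.
Lemma spec_mulDl : left_distributive spec_mul +%R.
Proof. by move=> s t u; apply: tilde_secP => p; apply: loc_actDl. Qed.

HB.instance Definition _ := GRing.Zmodule_isComPzRing.Build spec_sec
  spec_mulA spec_mulC spec_mul1 spec_mulDl.

End StructureSheaf.

Section TildeModule.
Variables (A : comPzRingType) (M : lmodType A) (V : opens (spec A)).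

Definition tilde_scale (a : spec_sec V) (s : tilde_sec M V) : tilde_sec M V :=
  tilde_act a s.

Lemma tilde_scaleA a b s :
  tilde_scale a (tilde_scale b s) = tilde_scale (a * b) s.
Proof. by apply: tilde_secP => p; apply: loc_actA. Qed.
Lemma tilde_scale1 : left_id 1 tilde_scale.
Proof. by move=> s; apply: tilde_secP => p; apply: loc_act1. Qed.
Lemma tilde_scaleDr : right_distributive tilde_scale +%R.
Proof. by move=> a s t; apply: tilde_secP => p; apply: loc_actDr. Qed.
Lemma tilde_scaleDl s : {morph tilde_scale^~ s : a b / a + b}.
Proof. by move=> a b; apply: tilde_secP => p; apply: loc_actDl. Qed.

HB.instance Definition _ := GRing.Zmodule_isLmodule.Build (spec_sec V)
  (tilde_sec M V) tilde_scaleA tilde_scale1 tilde_scaleDr tilde_scaleDl.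

End TildeModule.

Definition widen_pt (X : topologicalType) (U V : opens X) (h : V `<=` U)
    (p : set_type V) : set_type U :=
  exist _ (val p) (mem_set (h (val p) (set_valP p))).

Section TildeSheaf.
Variables (A : comPzRingType) (M : lmodType A).
Implicit Types U V W : opens (spec A).

Lemma tilde_res_loc U V (h : V `<=` U) (s : tilde_sec M U) :
  locally_fraction (fun p : set_type V => s (widen_pt h p)).
Proof.
move=> p; have [W Wp [m [f sE]]] := ts_loc s (widen_pt h p).
by exists W => //; exists m, f => q Wq; apply: sE (widen_pt h q) Wq.
Qed.

Definition tilde_res U V (h : V `<=` U) (s : tilde_sec M U) : tilde_sec M V :=
  TildeSec (tilde_res_loc h s).

Lemma tilde_resD U V (h : V `<=` U) : zmod_morphism (tilde_res h).
Proof. by move=> s t; apply: tilde_secP. Qed.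

HB.instance Definition _ U V (h : V `<=` U) :=
  GRing.isZmodMorphism.Build (tilde_sec M U) (tilde_sec M V) (tilde_res h)
    (tilde_resD h).

Lemma family_irr (T : spec A -> Type) U
    (s : forall p : set_type U, T (val p)) p (h h' : p \in opens_set U) :
  s (exist _ p h) = s (exist _ p h').
Proof. by rewrite (bool_irrelevance h h'). Qed.

Lemma tilde_res_id U (h : U `<=` U) s : tilde_res h s = s.
Proof.
by apply: tilde_secP => -[p Up]; rewrite /= /widen_pt /=; apply: (@family_irr (loc M) U s p).
Qed.

Lemma tilde_res_comp U V W (h : V `<=` U) (k : W `<=` V) (l : W `<=` U) s :
  tilde_res k (tilde_res h s) = tilde_res l s.
Proof.
by apply: tilde_secP => -[p Wp]; rewrite /= /widen_pt /=; apply: (@family_irr (loc M) U s p).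
Qed.

Lemma tilde_sheaf : sheaf_condition tilde_res.
Proof.
move=> I U V VU Ucov s sP.
have covP (p : set_type U) : exists i, opens_set (V i) (val p).
  by have [i _ Vp] := Ucov _ (set_valP p); exists i.
have [ix ixP] := choice covP.
pose pt p : set_type (V (ix p)) := SigSub (mem_set (ixP p)).
have glue (p : set_type U) i (Vp : val p \in opens_set (V i)) :
    s (ix p) (pt p) = s i (SigSub Vp).
  have Wp : val p \in opens_set (opensI (V (ix p)) (V i)).
    by apply/mem_set; split; [apply: ixP | apply: set_mem Vp].
  have := congr1 (fun t : tilde_sec _ _ => t (SigSub Wp)) (sP (ix p) i).
  by rewrite /= => sij; apply: etrans (etrans sij _); apply: (@family_irr (loc M)).
have t_loc : locally_fraction (fun p : set_type U => s (ix p) (pt p)).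
  move=> p; have [W Wp [m [f sE]]] := ts_loc (s (ix p)) (pt p).
  exists (opensI W (V (ix p))); first by split=> //; exact: ixP.
  exists m, f => q [Wq Vq]; rewrite (glue _ _ (mem_set Vq)).
  exact: sE (SigSub (mem_set Vq)) Wq.
exists (TildeSec t_loc); split=> [i|t tE].
  apply: tilde_secP => -[p Vp].
  exact: (glue (widen_pt (VU i) (exist _ p Vp)) i Vp).
apply: tilde_secP => -[p Up]; rewrite /= -tE /=; exact: (@family_irr (loc M)).
Qed.

End TildeSheaf.

Section Spec.
Variable A : comPzRingType.
Implicit Types U V W : opens (spec A).

Definition spec_res U V (h : V `<=` U) (s : spec_sec U) : spec_sec V :=
  tilde_res h s.

HB.instance Definition _ U V (h : V `<=` U) :=
  GRing.isZmodMorphism.Build (spec_sec U) (spec_sec V) (spec_res h)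
    (@tilde_resD A A^o U V h).

Lemma spec_res_monoid U V (h : V `<=` U) : monoid_morphism (spec_res h).
Proof. by split=> [|s t]; apply: tilde_secP. Qed.

HB.instance Definition _ U V (h : V `<=` U) :=
  GRing.isMonoidMorphism.Build (spec_sec U) (spec_sec V) (spec_res h)
    (spec_res_monoid h).

Definition Spec : ringed_space :=
  @RingedSpace (spec A) (@spec_sec A) (fun U V h => @spec_res U V h)
    (@tilde_res_id A A^o) (@tilde_res_comp A A^o) (@tilde_sheaf A A^o).

Definition tilde (M : lmodType A) : omodule Spec.
Proof.
refine (@OModule Spec (fun V => tilde_sec M V) (fun U V h => tilde_res h)
  _ (@tilde_res_id A M) (@tilde_res_comp A M) (@tilde_sheaf A M)).
by move=> U V h a s; apply: tilde_secP.
Defined.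

End Spec.

Definition affine_open (X : ringed_space) (U : opens X) : Prop :=
  exists A : comPzRingType, inhabited (ringed_iso (restrict_space U) (Spec A)).

(** It is enough to ask for isomorphisms of ringed spaces: the stalks of [X] are
    then automatically local, and so are the isomorphisms. *)
Record scheme := Scheme {
  sch_space :> ringed_space;
  sch_affine : forall x : sch_space, exists2 U : opens sch_space,
    opens_set U x & affine_open U
}.

Definition locally_coherent (X : scheme) : Prop :=
  forall U : opens X, affine_open U -> coherent_ring (rs_O U).

Definition quasi_coherent (X : scheme) (F : omodule X) : Prop :=
  forall x : X, exists2 U : opens X, opens_set U x &
    exists (A : comPzRingType) (phi : ringed_iso (restrict_space U) (Spec A))
      (M : lmodType A),
      inhabited (omodule_iso phi (restrict_module U F) (tilde M)).

Definition vector_bundle (X : scheme) (P : omodule X) : Prop :=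
  quasi_coherent P /\ forall U : opens X, affine_open U -> projective (P U).

Record sheaf_complex (X : scheme) := SheafComplex {
  sc_obj :> int -> omodule X;
  sc_d : forall n : int, omodule_hom (sc_obj (n + 1)) (sc_obj n);
  sc_dd : forall (n : int) (U : opens X) s,
    sc_d n U (sc_d (n + 1) U s) = 0
}.

Definition sections_complex (X : scheme) (F : sheaf_complex X) (U : opens X) :
    complex (rs_O U) :=
  @Complex (rs_O U) (fun n => F n U) (fun n => sc_d F n U)
    (fun n => @sc_dd X F n U).

Definition F_totally_acyclic_sheaf (X : scheme) (F : sheaf_complex X) : Prop :=
  (forall n, quasi_coherent (F n)) /\
  forall U : opens X, affine_open U -> F_totally_acyclic (sections_complex F U).

(* Main.v *)
Require Import Defs.
From HB Require Import structures.
From mathcomp Require Import all_boot all_algebra all_classical topology.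
From mathcomp Require Import generic_quotient.

(** Write [M^+] for [Hom_R(M, E)], where [E = Hom_Z(R, Q/Z)] is an injective
    cogenerator. If [I] is injective, then [Hom(P, I^+) = (I ⊗ P)^+] is acyclic.
    A projective module [Q] is flat, so [Q^+] is injective, and coherence of [R]
    makes [Q^++] flat. The embedding [Q -> Q^++] is pure, hence its cokernel is
    again flat, and iterating gives a pure exact coresolution
    [0 -> Q -> G_0 -> G_1 -> ...] in which every [Hom(P, G_k)] is acyclic.

    A map [f : P_(n+1) -> Q] killing boundaries therefore extends step by step
    to a chain map from [... -> P_(n+1) -> P_n -> P_(n-1) -> ...], truncated at
    [P_(n+1)], to this coresolution. Every chain map from a complex of
    projectives to a pure exact complex is null-homotopic (Neeman), and the
    first component [P_n -> Q] of a null homotopy extends [f]. For the null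
    homotopy, make the complex free, and extend a homotopy defined on a
    subcomplex spanned by basis elements by Zorn's lemma: adjoining one more
    basis element requires only finitely many others in each degree, so the
    cokernels of the quotient complex are finitely presented and purity
    applies. *)

Set Implicit Arguments.
Unset Strict Implicit.
Unset Printing Implicit Defensive.

Import GRing.Theory Num.Theory.
Local Open Scope classical_set_scope.
Local Open Scope ring_scope.
Local Open Scope quotient_scope.

(** * Submodules and quotient modules *)

Record submodule (R : comPzRingType) (V : lmodType R) := Submodule {
  submodule_set :> V -> Prop;
  submodule_closed : submodule_set 0 /\
    forall a x y, submodule_set x -> submodule_set y -> submodule_set (a *: x + y)
}.

Section SubmoduleType.
Variables (R : comPzRingType) (V : lmodType R) (S : submodule V).

Definition submodule_pred : {pred V} := fun x => `[< S x >].

Lemma submodule_predP : GRing.submod_closed submodule_pred.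
Proof.
have [S0 SD] := submodule_closed S; split; first exact/asboolP.
by move=> a x y /asboolP Sx /asboolP Sy; apply/asboolP/SD.
Qed.

HB.instance Definition _ :=
  GRing.isSubmodClosed.Build R V submodule_pred submodule_predP.

Record submodule_type := SubmoduleElt {
  submodule_val : V;
  _ : submodule_val \in submodule_pred
}.

HB.instance Definition _ := [isSub for submodule_val].
HB.instance Definition _ := [Choice of submodule_type by <:].
HB.instance Definition _ := [SubChoice_isSubLmodule of submodule_type by <:].

Lemma submodule_valP (x : submodule_type) : S (val x).
Proof. by apply/asboolP; exact: valP x. Qed.

Definition submodule_elt (x : V) (Sx : S x) : submodule_type :=
  SubmoduleElt (asboolT Sx : x \in submodule_pred).

End SubmoduleType.

Section QuotientModule.
Variables (R : comPzRingType) (V : lmodType R) (S : submodule V).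

Definition quot_eqb (x y : V) : bool := x - y \in submodule_pred S.

Lemma quot_eqb_refl : reflexive quot_eqb.
Proof. by move=> x; rewrite /quot_eqb subrr rpred0. Qed.

Lemma quot_eqb_sym : symmetric quot_eqb.
Proof. by move=> x y; rewrite /quot_eqb -opprB rpredN. Qed.

Lemma quot_eqb_trans : transitive quot_eqb.
Proof.
by move=> y x z xy yz; rewrite /quot_eqb -(subrK y x) -addrA rpredD.
Qed.

Canonical quot_equiv := EquivRel quot_eqb quot_eqb_refl quot_eqb_sym quot_eqb_trans.

Definition quot_mod := {eq_quot quot_eqb}.
HB.instance Definition _ := Choice.on quot_mod.
HB.instance Definition _ := EqQuotient.on quot_mod.

Let qpi (x : V) : quot_mod := \pi_quot_mod x.

Let qpiP x y : qpi x = qpi y <-> S (x - y).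
Proof. by split=> [/eqmodP/asboolP|Sxy]; last exact/eqmodP/asboolP. Qed.

Let qpiE x : S (repr (qpi x) - x).
Proof. by apply/qpiP; rewrite /qpi reprK. Qed.

Let SE a x y : S x -> S y -> S (a *: x + y).
Proof. by have [_] := submodule_closed S; apply. Qed.

Let quotW (P : quot_mod -> Prop) : (forall x, P (qpi x)) -> forall x, P x.
Proof. by move=> piP x; rewrite -[x]reprK; exact: piP. Qed.

(** Sum, multiples and opposite are all special cases of this one operation, so compatibility with
    the congruence is checked only once. *)
Definition quot_lin a (x y : quot_mod) : quot_mod := qpi (a *: repr x + repr y).

Let quot_linE a x y : quot_lin a (qpi x) (qpi y) = qpi (a *: x + y).
Proof. by apply/qpiP; rewrite opprD addrACA -scalerBr; apply: SE; exact: qpiE. Qed.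

Definition quot_add := quot_lin 1.
Definition quot_zero := qpi 0.
Definition quot_scale a x := quot_lin a x quot_zero.
Definition quot_opp := quot_scale (-1).

Let quot_addE x y : quot_add (qpi x) (qpi y) = qpi (x + y).
Proof. by rewrite /quot_add quot_linE scale1r. Qed.

Let quot_scaleE a x : quot_scale a (qpi x) = qpi (a *: x).
Proof. by rewrite /quot_scale quot_linE addr0. Qed.

Lemma quot_addA : associative quot_add.
Proof.
by elim/quotW=> x; elim/quotW=> y; elim/quotW=> z; rewrite !quot_addE addrA.
Qed.
Lemma quot_addC : commutative quot_add.
Proof. by elim/quotW=> x; elim/quotW=> y; rewrite !quot_addE addrC. Qed.
Lemma quot_add0 : left_id quot_zero quot_add.
Proof. by elim/quotW=> x; rewrite quot_addE add0r. Qed.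
Lemma quot_addN : left_inverse quot_zero quot_opp quot_add.
Proof. by elim/quotW=> x; rewrite /quot_opp quot_scaleE quot_addE scaleN1r addNr. Qed.

HB.instance Definition _ := GRing.isZmodule.Build quot_mod
  quot_addA quot_addC quot_add0 quot_addN.

Lemma quot_scaleA a b x : quot_scale a (quot_scale b x) = quot_scale (a * b) x.
Proof. by elim/quotW: x => x; rewrite !quot_scaleE scalerA. Qed.
Lemma quot_scale1 : left_id 1 quot_scale.
Proof. by elim/quotW=> x; rewrite quot_scaleE scale1r. Qed.
Lemma quot_scaleDr : right_distributive quot_scale +%R.
Proof.
move=> a; elim/quotW=> x; elim/quotW=> y.
by rewrite [X in quot_scale _ X]quot_addE !quot_scaleE [RHS]quot_addE scalerDr.
Qed.
Lemma quot_scaleDl x : {morph quot_scale^~ x : a b / a + b}.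
Proof.
move=> a b; elim/quotW: x => x.
by rewrite !quot_scaleE [RHS]quot_addE scalerDl.
Qed.

HB.instance Definition _ := GRing.Zmodule_isLmodule.Build R quot_mod
  quot_scaleA quot_scale1 quot_scaleDr quot_scaleDl.

Definition quot_pi (x : V) : quot_mod := qpi x.

Lemma quot_pi_linear : linear quot_pi.
Proof.
by move=> a x y; rewrite /quot_pi -quot_addE -quot_scaleE.
Qed.

HB.instance Definition _ :=
  GRing.isLinear.Build R V quot_mod *:%R quot_pi quot_pi_linear.

Lemma quot_pi_surj y : exists x, quot_pi x = y.
Proof. by elim/quotW: y => x; exists x. Qed.

Lemma quot_pi_eq0 x : quot_pi x = 0 <-> S x.
Proof. by rewrite -[X in S X]subr0; exact: qpiP. Qed.

End QuotientModule.


(** * Injective modules and an injective cogenerator *)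

Definition linear_pack (R : comPzRingType) (U V : lmodType R) (f : U -> V)
  (fl : linear f) : {linear U -> V} :=
  HB.pack f (GRing.isLinear.Build R U V *:%R f fl).

(** * Baer's criterion *)

Section Baer.
Variable R : comPzRingType.
Implicit Types E : lmodType R.

(** Injectivity in a form that admits a non-injective [g]: a map killing the kernel of [g] factors
    through the image of [g], and this form spares constructing that image. *)
Definition extends_maps E : Prop :=
  forall (M N : lmodType R) (g : {linear M -> N}) (f : {linear M -> E}),
    (forall x, g x = 0 -> f x = 0) ->
    exists h : {linear N -> E}, forall x, h (g x) = f x.

(** A map on an ideal is encoded by a total function [phi] that matters only on [J], which avoids a
    subtype. *)
Definition baer E : Prop :=
  forall (J : R -> Prop) (phi : R -> E), J 0 ->
    (forall a x y, J x -> J y ->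
      J (a * x + y) /\ phi (a * x + y) = a *: phi x + phi y) ->
    exists e, forall a, J a -> phi a = a *: e.

Lemma extends_maps_injective E : extends_maps E -> injective_module E.
Proof.
move=> Eext M N g f g_inj; apply: Eext => x gx0.
by rewrite (g_inj x 0) ?raddf0.
Qed.

Section Extension.
Variables (E M N : lmodType R) (g : {linear M -> N}) (f : {linear M -> E}).
Hypothesis gf : forall x, g x = 0 -> f x = 0.

Record partial_map := PartialMap {
  pm_dom : submodule N;
  pm_fun : N -> E;
  pm_lin : forall a x y, pm_dom x -> pm_dom y ->
    pm_fun (a *: x + y) = a *: pm_fun x + pm_fun y;
  pm_ext : forall x, pm_dom (g x) /\ pm_fun (g x) = f x
}.

Definition pm_le (p q : partial_map) : bool :=
  `[< forall x, pm_dom p x -> pm_dom q x /\ pm_fun q x = pm_fun p x >].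

Lemma pm_base : inhabited partial_map.
Proof.
pose S y := exists x, g x = y.
have Scl : S 0 /\ forall a x y, S x -> S y -> S (a *: x + y).
  split; first by exists 0; rewrite raddf0.
  by move=> a _ _ [x <-] [y <-]; exists (a *: x + y); rewrite linearP.
have /choice[h hP] y : exists e, forall x, g x = y -> f x = e.
  have [[x <-]|nSy] := pselect (S y); last by exists 0 => x gx; case: nSy; exists x.
  exists (f x) => x' gx; apply/eqP; rewrite -subr_eq0 -raddfB; apply/eqP/gf.
  by rewrite raddfB /= gx subrr.
apply: inhabits; apply: (@PartialMap (Submodule Scl) h) => [a _ _ [x <-] [y <-]|x].
  by rewrite -(hP _ _ (linearP g a x y)) -!(hP _ _ erefl) linearP.
by split; [exists x | rewrite -(hP _ x)].
Qed.

Lemma pm_refl p : pm_le p p.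
Proof. exact/asboolP. Qed.

Lemma pm_trans p q r : pm_le p q -> pm_le q r -> pm_le p r.
Proof.
by move=> /asboolP pq /asboolP qr; apply/asboolP => x /pq[/qr[? ->]].
Qed.

Lemma pm_chain (A : set partial_map) : total_on A pm_le ->
  exists t, forall s, A s -> pm_le s t.
Proof.
move=> Atot; have [base] := pm_base.
have [[p0 Ap0]|A0] := pselect (exists p, A p); last first.
  by exists base => s As; case: A0; exists s.
pose S x := exists2 p, A p & pm_dom p x.
have common x y : S x -> S y -> exists p, [/\ A p, pm_dom p x & pm_dom p y].
  move=> [p Ap px] [q Aq qy].
  have [/asboolP/(_ _ px)[? _]|/asboolP/(_ _ qy)[? _]] := Atot p q Ap Aq.
    by exists q.
  by exists p.
have Scl : S 0 /\ forall a x y, S x -> S y -> S (a *: x + y).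
  split; first by exists p0 => //; case: (submodule_closed (pm_dom p0)).
  move=> a x y Sx Sy; have [p [Ap px py]] := common x y Sx Sy.
  by exists p => //; apply: (submodule_closed (pm_dom p)).2.
have /choice[h hP] x : exists e, forall p, A p -> pm_dom p x -> pm_fun p x = e.
  have [[p Ap px]|nSx] := pselect (S x); last first.
    by exists 0 => p Ap px; case: nSx; exists p.
  exists (pm_fun p x) => q Aq qx.
  by have [/asboolP/(_ _ px)[_ ->]|/asboolP/(_ _ qx)[_ ->]] :=
    Atot p q Ap Aq.
have hl a x y : S x -> S y -> h (a *: x + y) = a *: h x + h y.
  move=> Sx Sy; have [p [Ap px py]] := common x y Sx Sy.
  rewrite -!(hP _ p) ?pm_lin //.
  exact: (submodule_closed (pm_dom p)).2.
have hext x : S (g x) /\ h (g x) = f x.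
  have [px fx] := pm_ext p0 x.
  by split; [exists p0 | rewrite -(hP _ p0)].
exists (@PartialMap (Submodule Scl) h hl hext) => p Ap.
by apply/asboolP => x px /=; split; [exists p | rewrite -(hP _ p)].
Qed.

(** A maximal partial map is total: Baer's condition, applied to the ideal of all [a] with [a *: x]
    in the domain, provides a value [e] for any further [x]. *)
Lemma pm_total : baer E -> exists h : {linear N -> E}, forall x, h (g x) = f x.
Proof.
move=> Ebaer; have [base] := pm_base.
have [p pmax] := ZL_preorder base pm_refl pm_trans pm_chain.
suff pT x : pm_dom p x.
  have hl : linear (pm_fun p) by move=> a x y; rewrite pm_lin.
  by exists (linear_pack hl) => x; have [] := pm_ext p x.
have [S0 SD] := submodule_closed (pm_dom p).
have SN y : pm_dom p y -> pm_dom p (- y).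
  by move=> py; rewrite -[- y]addr0 -scaleN1r; apply: SD.
have hl := @pm_lin p; have h0 : pm_fun p 0 = 0.
  by have := hl (-1) 0 0 S0 S0; rewrite scaler0 addr0 scaleN1r addNr.
have [||e eP] := Ebaer (fun a => pm_dom p (a *: x)) (fun a => pm_fun p (a *: x)).
- by rewrite scale0r.
- by move=> a b c pb pc; rewrite scalerDl -scalerA; split; [apply: SD | rewrite hl].
pose S y := exists s a, pm_dom p s /\ y = s + a *: x.
have Scl : S 0 /\ forall a y z, S y -> S z -> S (a *: y + z).
  split; first by exists 0, 0; rewrite scale0r addr0.
  move=> a _ _ [s [b [ps ->]]] [t [c [pt ->]]]; exists (a *: s + t), (a * b + c).
  by split; [apply: SD | rewrite scalerDr scalerDl scalerA addrACA].
(* Two decompositions of [y] differ by a multiple of [x] lying in the domain, where [eP] shows that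
   the two values agree. *)
have /choice[h hP] y : exists v, forall s a, pm_dom p s -> y = s + a *: x ->
    v = pm_fun p s + a *: e.
  have [[s [a [ps ->]]]|nSy] := pselect (S y); last first.
    by exists 0 => s a ps yE; case: nSy; exists s, a.
  exists (pm_fun p s + a *: e) => t b pt sE.
  have dE : s - t = (b - a) *: x.
    rewrite scalerBl; have -> : s = t + b *: x - a *: x by rewrite -sE addrK.
    by rewrite addrC !addrA addNr add0r.
  have pd : pm_dom p (s - t).
    by rewrite -[s]scale1r; apply: SD => //; exact: SN.
  have := eP (b - a); rewrite -dE => /(_ pd).
  rewrite addrC -[- t]scaleN1r hl // scaleN1r scalerBl => sE'.
  have -> : pm_fun p s = pm_fun p t + (b *: e - a *: e).
    by rewrite -sE' addrA subrr add0r.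
  by rewrite -addrA subrK.
have hS s a : pm_dom p s -> h (s + a *: x) = pm_fun p s + a *: e.
  by move=> ps; apply: hP.
have hl' a y z : S y -> S z -> h (a *: y + z) = a *: h y + h z.
  move=> [s [b [ps ->]]] [t [c [pt ->]]].
  rewrite scalerDr addrACA scalerA -scalerDl !hS ?hl //; last exact: SD.
  by rewrite scalerDr scalerDl scalerA addrACA.
have hp y : pm_dom p y -> S y /\ h y = pm_fun p y.
  move=> py; split; first by exists y, 0; rewrite scale0r addr0.
  by rewrite -[y in h y]addr0 -(scale0r x) hS // scale0r addr0.
have hext y : S (g y) /\ h (g y) = f y.
  by have [/hp[? ->]] := pm_ext p y.
have /pmax/asboolP : pm_le p (@PartialMap (Submodule Scl) h hl' hext).
  exact/asboolP.
by case/(_ x) => //=; exists 0, 1; rewrite scale1r add0r.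
Qed.

End Extension.

Lemma baer_extends_maps E : baer E -> extends_maps E.
Proof. by move=> Ebaer M N g f gf; exact: pm_total. Qed.

End Baer.

(** * The injective cogenerator Q/Z of abelian groups *)

Section IntModules.

Lemma int_linear (V W : lmodType int) (f : V -> W) :
  (forall x y, f (x + y) = f x + f y) -> linear f.
Proof.
move=> fD.
have f0 : f 0 = 0 by apply: (addrI (f 0)); rewrite -fD !addr0.
have fN x : f (- x) = - f x by apply/eqP; rewrite -addr_eq0 -fD addNr f0.
have fZ n x : f (n%:Z *: x) = n%:Z *: f x.
  elim: n => [|n IHn]; first by rewrite !scale0r.
  by rewrite -addn1 PoszD !scalerDl !scale1r fD IHn.
move=> [n|n] x y; rewrite fD ?fZ //; congr (_ + _).
by rewrite NegzE !scaleNr fN fZ.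
Qed.

Definition rat_mod : lmodType int := zmodule rat.

Lemma rat_scaleE (a : int) (q : rat) : a *: (q : rat_mod) = a%:~R * q :> rat.
Proof. by rewrite scalezrE -mulrzl. Qed.

Definition rat_int (x : rat_mod) : Prop := exists n : int, x = n%:~R :> rat.

Lemma rat_int_closed : rat_int 0 /\
  forall (a : int) x y, rat_int x -> rat_int y -> rat_int (a *: x + y).
Proof.
split; first by exists 0.
move=> a _ _ [m ->] [n ->]; exists (a * m + n).
by rewrite rat_scaleE rmorphD rmorphM.
Qed.

Definition QZ : lmodType int := quot_mod (Submodule rat_int_closed).

Lemma QZ_divisible (n : int) (x : QZ) : n != 0 -> exists y, n *: y = x.
Proof.
move=> n0; have [q <-] := quot_pi_surj x.
exists (quot_pi _ (n%:~R^-1 * (q : rat) : rat_mod)).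
rewrite -linearZ; congr quot_pi.
by rewrite rat_scaleE mulrA mulfV ?mul1r // intr_eq0.
Qed.

(** An ideal of Z is zero or generated by its least positive element [d]; in the latter case
    divisibility yields [e] with [d *: e = phi d]. *)
Lemma QZ_extends_maps : extends_maps QZ.
Proof.
apply: baer_extends_maps => J phi J0 JD.
have phi0 : phi 0 = 0.
  have [_] := JD 1 0 0 J0 J0; rewrite mul1r addr0 scale1r.
  by rewrite -{1}[phi 0]addr0 => /addrI.
have phiZ a x : J x -> J (a * x) /\ phi (a * x) = a *: phi x.
  by move=> Jx; have := JD a x 0 Jx J0; rewrite phi0 !addr0.
have [Jpos|Jnpos] := pselect (exists n, (0 < n)%N && `[< J n%:Z >]); last first.
  exists 0 => a Ja; rewrite scaler0; have [->//|a0] := eqVneq a 0.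
  case: Jnpos; exists `|a|%N; rewrite absz_gt0 a0; apply/asboolP.
  by rewrite abszE normrEsg; case: (phiZ (Num.sg a) a Ja).
case: (ex_minnP Jpos) => d /andP[d0 /asboolP Jd] dmin.
have dn0 : d%:Z != 0 by rewrite eqz_nat -lt0n.
have [e eE] := QZ_divisible (phi d%:Z) dn0; exists e => a Ja.
have [Jr phir] := JD (- (a %/ d%:Z)%Z) _ _ Jd Ja.
have rE : - (a %/ d%:Z)%Z * d%:Z + a = (a %% d%:Z)%Z.
  by rewrite /modz mulNr addrC.
have r0 : (a %% d%:Z)%Z = 0.
  move: Jr; rewrite rE; have := ltz_mod a dn0; have := modz_ge0 a dn0.
  case: (a %% d%:Z)%Z => // -[//|r] _; rewrite ltz_nat => /= rd Jr.
  suff : (d <= r.+1)%N by rewrite leqNgt rd.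
  by apply: dmin; exact: asboolT.
move: phir; rewrite rE r0 phi0 => /esym/eqP.
rewrite scaleNr addrC subr_eq0 => /eqP ->.
by rewrite -eE scalerA {2}(divz_eq a d) r0 addr0.
Qed.

Lemma inv_not_int (d : nat) : (1 < d)%N -> ~ rat_int (d%:Z%:~R^-1 : rat).
Proof.
move=> d1 [n nE]; have : (d%:Z * n)%:~R = 1%:~R :> rat.
  by rewrite intrM -nE mulfV // intr_eq0 eqz_nat -lt0n (ltnW d1).
move/eqP; rewrite eqr_int => /eqP/(congr1 absz)/eqP.
by rewrite abszM muln_eq1 => /andP[/eqP dE]; rewrite /= in dE; rewrite dE in d1.
Qed.

Definition cogenerator (R : comPzRingType) (E : lmodType R) : Prop :=
  forall (M : lmodType R) (x : M), x <> 0 -> exists f : {linear M -> E}, f x <> 0.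

(** It suffices to map the subgroup generated by [x] and then extend. Sending [x] to the class of
    [q] is well defined if [n * q] is an integer whenever [n *: x = 0]: take [q] = 1/2 if [x] has
    infinite order and [q] = 1/d if it has order d. *)
Lemma QZ_cogenerator : cogenerator QZ.
Proof.
move=> M x x0.
suff [q [qP q1]] : exists q : rat, (forall n : int, n *: x = 0 ->
    rat_int (n%:~R * q)) /\ ~ rat_int q.
  have gl : linear (fun n : int^o => (n : int) *: x).
    by move=> a m n; rewrite scalerDl -scalerA.
  have fl : linear (fun n : int^o =>
      quot_pi (Submodule rat_int_closed) (n%:~R * q : rat)).
    apply: int_linear => m n; rewrite -raddfD; congr quot_pi.
    by rewrite rmorphD /= mulrDl.
  have [|h hP] := @QZ_extends_maps _ _ (linear_pack gl) (linear_pack fl).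
    by move=> n /= nx0; apply/quot_pi_eq0; exact: qP.
  exists h => hx0; have := hP 1; rewrite /= scale1r hx0 => /esym/quot_pi_eq0.
  by rewrite /= mul1r.
have [Jpos|Jnpos] := pselect (exists n, (0 < n)%N && (n%:Z *: x == 0)); last first.
  have tf n : n *: x = 0 -> n = 0.
    move=> nx0; apply/eqP/negPn/negP => n0; case: Jnpos; exists `|n|%N.
    by rewrite absz_gt0 n0 abszE normrEsg -scalerA nx0 scaler0 eqxx.
  exists 2%:Z%:~R^-1; split; last exact: inv_not_int.
  by move=> n /tf ->; exists 0; rewrite mul0r.
case: (ex_minnP Jpos) => d /andP[d0 /eqP dx0] dmin.
have dn0 : d%:Z != 0 by rewrite eqz_nat -lt0n.
exists d%:Z%:~R^-1; split=> [n nx0|].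
  have r0 : (n %% d%:Z)%Z = 0.
    have : (n %% d%:Z)%Z *: x = 0.
      move: nx0; rewrite {1}(divz_eq n d) scalerDl -scalerA dx0 scaler0 add0r //.
    have := ltz_mod n dn0; have := modz_ge0 n dn0.
    case: (n %% d%:Z)%Z => // -[//|r] _; rewrite ltz_nat => /= rd rx0.
    suff : (d <= r.+1)%N by rewrite leqNgt rd.
    by apply: dmin; rewrite rx0 eqxx.
  exists (n %/ d)%Z; rewrite {1}(divz_eq n d) r0 addr0 intrM mulfK //.
  by rewrite intr_eq0.
apply: inv_not_int; rewrite ltn_neqAle d0 andbT; apply/eqP => dE.
by apply: x0; rewrite -dE scale1r in dx0.
Qed.

End IntModules.

(** * The injective cogenerator Hom_Z(R, Q/Z) of R-modules *)

Section InjectiveCogenerator.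
Variable R : comPzRingType.

Definition additive_map (phi : R -> QZ) : Prop :=
  forall s t, phi (s + t) = phi s + phi t.

Lemma additive_map_closed : additive_map 0 /\ forall (a : int) phi psi,
  additive_map phi -> additive_map psi -> additive_map (a *: phi + psi).
Proof.
split=> [s t|a phi psi phiD psiD s t]; first by rewrite [RHS]addr0.
by rewrite !fctE phiD psiD scalerDr addrACA.
Qed.

(** The [R]-module [Hom_Z(R, Q/Z)]. *)
Definition coind : Type := submodule_type (Submodule additive_map_closed).
HB.instance Definition _ := GRing.Zmodule.on coind.

Definition coind_val (phi : coind) : R -> QZ := val phi.

Lemma coindP (phi psi : coind) : coind_val phi =1 coind_val psi -> phi = psi.
Proof. by move=> eq_phi; apply/val_inj/funext. Qed.

Lemma coind_valD phi psi s :
  coind_val (phi + psi) s = coind_val phi s + coind_val psi s.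
Proof. by rewrite /coind_val raddfD. Qed.

Lemma coind_additive phi s t :
  coind_val phi (s + t) = coind_val phi s + coind_val phi t.
Proof. exact: (@submodule_valP _ _ (Submodule additive_map_closed) phi). Qed.

Lemma coind_scale_subproof a (phi : coind) :
  additive_map (fun s => coind_val phi (s * a)).
Proof. by move=> s t; rewrite mulrDl coind_additive. Qed.

Definition coind_scale a phi : coind :=
  submodule_elt (S := Submodule additive_map_closed) (coind_scale_subproof a phi).

Lemma coind_scale_val a phi s :
  coind_val (coind_scale a phi) s = coind_val phi (s * a).
Proof. by []. Qed.

Lemma coind_scaleA a b phi :
  coind_scale a (coind_scale b phi) = coind_scale (a * b) phi.
Proof. by apply: coindP => s; rewrite !coind_scale_val mulrA. Qed.
Lemma coind_scale1 : left_id 1 coind_scale.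
Proof. by move=> phi; apply: coindP => s; rewrite coind_scale_val mulr1. Qed.
Lemma coind_scaleDr : right_distributive coind_scale +%R.
Proof.
by move=> a phi psi; apply: coindP => s; rewrite !(coind_scale_val, coind_valD).
Qed.
Lemma coind_scaleDl phi : {morph coind_scale^~ phi : a b / a + b}.
Proof.
move=> a b; apply: coindP => s.
by rewrite coind_valD !coind_scale_val mulrDr coind_additive.
Qed.

HB.instance Definition _ := GRing.Zmodule_isLmodule.Build R coind
  coind_scaleA coind_scale1 coind_scaleDr coind_scaleDl.

(** Additive maps to Q/Z correspond to linear maps to [coind], with inverse evaluation at 1. This
    transfers both properties of Q/Z to [coind]. *)
Lemma coind_adjunct (M : lmodType R) (h : M -> QZ) :
  (forall x y, h (x + y) = h x + h y) ->
  exists k : {linear M -> coind}, forall x s, coind_val (k x) s = h (s *: x).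
Proof.
move=> hD.
have kP x : additive_map (fun s => h (s *: x)).
  by move=> s t; rewrite scalerDl hD.
pose k x : coind := submodule_elt (S := Submodule additive_map_closed) (kP x).
have kl : linear k.
  move=> a x y; apply: coindP => s.
  by rewrite coind_valD coind_scale_val /k /coind_val /= scalerDr hD scalerA.
by exists (linear_pack kl).
Qed.

Lemma coind_extends_maps : extends_maps coind.
Proof.
move=> M N g f gf.
have gl : linear (g : zmodule M -> zmodule N).
  by apply: int_linear => x y; rewrite raddfD.
have fl : linear (fun x : zmodule M => coind_val (f x) 1).
  by apply: int_linear => x y; rewrite raddfD coind_valD.
have [|h hP] := @QZ_extends_maps _ _ (linear_pack gl) (linear_pack fl).
  by move=> x /= /gf ->; rewrite /coind_val raddf0.
have [|k kP] := @coind_adjunct N h; first by move=> x y; rewrite raddfD.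
exists k => x; apply: coindP => s.
rewrite kP -linearZ; apply: etrans (hP (s *: x)) _.
by rewrite /= linearZ coind_scale_val mul1r.
Qed.

Lemma coind_cogenerator : cogenerator coind.
Proof.
move=> M x x0; have [h hx] := @QZ_cogenerator (zmodule M) x x0.
have [|k kP] := @coind_adjunct M h; first by move=> y z; rewrite raddfD.
by exists k => kx; apply: hx; rewrite -[x]scale1r -kP kx /coind_val raddf0.
Qed.

End InjectiveCogenerator.

(** * The module Hom(M, E) *)

Section Dual.
Variables (R : comPzRingType) (E M : lmodType R).

Lemma linear_closed_subproof : linear (0 : M -> E) /\
  forall a (f g : M -> E), linear f -> linear g -> linear (a *: f + g).
Proof.
split=> [b x y|a f g fl gl b x y]; first by rewrite [RHS]addr0 scaler0.
rewrite !fctE fl gl !scalerDr addrACA !scalerA; congr (_ + _ + _).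
by rewrite mulrC.
Qed.

Definition dual : lmodType R := submodule_type (Submodule linear_closed_subproof).

Definition dual_fun (f : dual) : M -> E := val f.

Lemma dual_fun_linear f : linear (dual_fun f).
Proof. exact: submodule_valP f. Qed.

HB.instance Definition _ f :=
  GRing.isLinear.Build R M E *:%R (dual_fun f) (dual_fun_linear f).

Definition dual_pack (f : M -> E) (fl : linear f) : dual :=
  submodule_elt (S := Submodule linear_closed_subproof) fl.

Lemma dualP (f g : dual) : dual_fun f =1 dual_fun g -> f = g.
Proof. by move=> eq_fg; apply/val_inj/funext. Qed.

Lemma dual_funP a (f g : dual) x :
  dual_fun (a *: f + g) x = a *: dual_fun f x + dual_fun g x.
Proof. by rewrite /dual_fun linearP. Qed.

Lemma dual_eval_linear x : linear (dual_fun^~ x).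
Proof. by move=> a f g; exact: dual_funP. Qed.

Lemma dual_fun0 x : dual_fun 0 x = 0.
Proof. exact: (raddf0 (linear_pack (dual_eval_linear x))). Qed.

Lemma dual_funZ a (f : dual) x : dual_fun (a *: f) x = a *: dual_fun f x.
Proof. by rewrite -[a *: f]addr0 dual_funP dual_fun0 addr0. Qed.

Lemma dual_fun_sum (I : Type) (r : seq I) (F : I -> dual) x :
  dual_fun (\sum_(i <- r) F i) x = \sum_(i <- r) dual_fun (F i) x.
Proof. exact: (raddf_sum (linear_pack (dual_eval_linear x))). Qed.

End Dual.

(** * Flatness, duals and coherence *)

Section FlatDual.
Variable R : comPzRingType.

(** Flatness in the form of the equational criterion. *)
Definition eqflat (F : lmodType R) : Prop :=
  forall (I : finType) (a : I -> R) (g : I -> F), \sum_i a i *: g i = 0 ->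
  exists (J : finType) (b : I -> J -> R) (h : J -> F),
    (forall i, g i = \sum_j b i j *: h j) /\ (forall j, \sum_i a i * b i j = 0).

Lemma submodule_extend (E F : lmodType R) (S : submodule F) (h : F -> E) :
  extends_maps E ->
  (forall a x y, S x -> S y -> h (a *: x + y) = a *: h x + h y) ->
  exists k : {linear F -> E}, forall x, S x -> k x = h x.
Proof.
move=> Eext hl.
have vl : linear (fun x : submodule_type S => val x : F).
  by move=> a x y; rewrite linearP.
have hvl : linear (fun x : submodule_type S => h (val x)).
  by move=> a x y; rewrite linearP hl //; exact: submodule_valP.
have [|k kP] := Eext _ _ (linear_pack vl) (linear_pack hvl).
  move=> x x0; have -> : x = 0 by apply/val_inj; rewrite raddf0; exact: x0.
  exact: raddf0.
by exists k => x Sx; have := kP (submodule_elt Sx).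
Qed.

(** By Baer's criterion. A map [phi] from an ideal J to Hom(F, E) amounts to a map from J ⊗ F to E;
    flatness lets it descend to the submodule JF of F, sending a sum of [a i *: g i] to the sum of
    [phi (a i)] at [g i]. Extended to F by injectivity of E, it is the element of the dual that is
    sought. *)
Lemma eqflat_dual_extends (E F : lmodType R) :
  extends_maps E -> eqflat F -> extends_maps (dual E F).
Proof.
move=> Eext Fflat; apply: baer_extends_maps => J phi J0 JD.
have phi0 : phi 0 = 0.
  have [_] := JD 1 0 0 J0 J0; rewrite mul1r addr0 scale1r.
  by rewrite -{1}[phi 0]addr0 => /addrI.
have Jlin (I : finType) (a b : I -> R) : (forall i, J (a i)) ->
    J (\sum_i b i * a i) /\ phi (\sum_i b i * a i) = \sum_i b i *: phi (a i).
  move=> Ja; elim: (index_enum I) => [|i s [Js IHs]]; first by rewrite !big_nil.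
  by rewrite !big_cons -IHs; exact: JD.
pose ev (I : finType) (a : I -> R) (g : I -> F) := \sum_i dual_fun (phi (a i)) (g i).
(* Flatness rewrites the [g i] through elements [h j] whose coefficients are relations among the
   [a i], and [phi] respects those relations. *)
have ev0 (I : finType) (a : I -> R) (g : I -> F) : (forall i, J (a i)) ->
    \sum_i a i *: g i = 0 -> ev I a g = 0.
  move=> Ja /Fflat[K [b [h [gE ab0]]]].
  transitivity (\sum_j dual_fun (\sum_i b i j *: phi (a i)) (h j)).
    rewrite /ev; under eq_bigr do rewrite gE raddf_sum.
    rewrite exchange_big; apply: eq_bigr => j _ /=.
    by rewrite dual_fun_sum; apply: eq_bigr => i _; rewrite dual_funZ !linearZ.
  apply: big1 => j _; rewrite -(Jlin _ _ _ Ja).2.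
  under eq_bigr do rewrite mulrC.
  by rewrite ab0 phi0 dual_fun0.
pose S x := exists (I : finType) (a : I -> R) (g : I -> F),
  (forall i, J (a i)) /\ x = \sum_i a i *: g i.
(* Concatenation of two families, which represents a sum of two elements of JF. *)
pose glue (I I' : finType) T (f : I -> T) (f' : I' -> T) (i : I + I') :=
  match i with inl j => f j | inr j => f' j end.
have glueJ (I I' : finType) (a : I -> R) (a' : I' -> R) : (forall i, J (a i)) ->
  (forall i, J (a' i)) -> forall i, J (glue _ _ _ a a' i) by move=> ? ? [].
have glueE (I I' : finType) (a : I -> R) (a' : I' -> R) g g' c :
    \sum_i glue _ _ _ a a' i *: glue _ _ F (fun i => c *: g i) g' i =
    c *: (\sum_i a i *: g i) + \sum_i a' i *: g' i.
  rewrite big_sumType /= scaler_sumr; congr (_ + _); apply: eq_bigr => i _.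
  by rewrite !scalerA mulrC.
have Scl : S 0 /\ forall a x y, S x -> S y -> S (a *: x + y).
  split.
    exists void, (of_void R), (of_void F); split=> [[]|].
    by rewrite big1 // => -[].
  move=> c _ _ [I [a [g [Ja ->]]]] [I' [a' [g' [Ja' ->]]]].
  exists (I + I')%type, (glue _ _ _ a a'), (glue _ _ _ (fun i => c *: g i) g').
  by split; [exact: glueJ | rewrite glueE].
have /choice[h hP] x : exists e, forall (I : finType) (a : I -> R) (g : I -> F),
    (forall i, J (a i)) -> x = \sum_i a i *: g i -> e = ev I a g.
  have [[I [a [g [Ja ->]]]]|nSx] := pselect (S x); last first.
    by exists 0 => I a g Ja xE; case: nSx; exists I, a, g.
  exists (ev I a g) => I' a' g' Ja' gE.
  apply/eqP; rewrite -subr_eq0; apply/eqP.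
  have := ev0 _ _ (glue _ _ _ g (fun i => - g' i)) (glueJ _ _ _ _ Ja Ja').
  rewrite /ev !big_sumType /= gE; under eq_bigr do rewrite scalerN.
  rewrite sumrN; rewrite subrr => /(_ erefl).
  by under [X in _ + X = _ -> _]eq_bigr do rewrite raddfN; rewrite sumrN.
have hE (I : finType) (a : I -> R) (g : I -> F) : (forall i, J (a i)) ->
  h (\sum_i a i *: g i) = ev I a g by move=> Ja; exact: hP.
have [|k kP] := @submodule_extend E F (Submodule Scl) h Eext.
  move=> c _ _ [I [a [g [Ja ->]]]] [I' [a' [g' [Ja' ->]]]].
  rewrite -glueE !hE //; last exact: glueJ.
  rewrite /ev big_sumType /= scaler_sumr; congr (_ + _); apply: eq_bigr => i _.
  by rewrite linearZ.
exists (dual_pack (linearP k)) => a Ja; apply: dualP => x.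
have := hE _ (fun _ : unit => a) (fun=> x) (fun=> Ja).
rewrite /ev !big_const card_unit /= !addr0 => <-.
have Sax : S (a *: x).
  exists unit, (fun=> a), (fun=> x); split=> //.
  by rewrite big_const card_unit /= addr0.
by rewrite -kP // linearZ dual_funZ.
Qed.

End FlatDual.

Section FiniteProducts.
Variables (R : comPzRingType) (I : finType) (V : lmodType R).

Definition single (i : I) (v : V) : I -> V := fun j => if j == i then v else 0.

Lemma single_linear i : linear (single i).
Proof.
move=> a u v; apply/funext => j; rewrite /single !fctE.
by case: eqP => // _; rewrite scaler0 addr0.
Qed.

Lemma singleZ i a v : single i (a *: v) = a *: single i v.
Proof.
by apply/funext => j; rewrite /single !fctE; case: eqP => // _; rewrite scaler0.
Qed.

Lemma sum_single (w : I -> V) : w = \sum_i single i (w i).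
Proof.
apply/funext => j; rewrite fct_sumE (bigD1 j) //= {1}/single eqxx big1 ?addr0 //.
by move=> i ij; rewrite /single eq_sym (negbTE ij).
Qed.

Lemma linear_sum_single (W : lmodType R) (f : {linear (I -> V) -> W}) w :
  f w = \sum_i f (single i (w i)).
Proof. by rewrite {1}[w]sum_single raddf_sum. Qed.

Lemma linear_comb_linear (a : I -> R) : linear (fun x : I -> V => \sum_i a i *: x i).
Proof.
move=> c x y; rewrite scaler_sumr -big_split /=; apply: eq_bigr => i _.
by rewrite !fctE scalerDr !scalerA mulrC.
Qed.

End FiniteProducts.

(** Coherence presents the ideal generated by [a] through some map [f] from a free module, whose
    basis need not map to [a]. The finitely many relations must therefore be carried over, by lifts
    [u] of the [a i] to that free module and a map [V] back to coefficients of [a]. *)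
Lemma coherent_relations (R : comPzRingType) : coherent_ring R ->
  forall (I : finType) (a : I -> R),
  exists (J : finType) (b : J -> I -> R),
    (forall j, \sum_i b j i * a i = 0) /\
    (forall c : I -> R, \sum_i c i * a i = 0 ->
      exists e : J -> R, forall i, c i = \sum_j e j * b j i).
Proof.
move=> Rcoh I a.
pose a' (i : 'I_#|I|) : R^o := a (enum_val i).
have [|p [f [fI [q [kappa kerE]]]]] :=
  Rcoh [set x | exists c : 'I_#|I| -> R, x = \sum_i c i *: a' i].
  by exists #|I|, a'.
have sumE (F : 'I_#|I| -> R) : \sum_i F i = \sum_i F (enum_rank i).
  by rewrite (reindex enum_rank) //; exact/onW_bij/enum_rank_bij.
have /choice[u uP] i : exists v, f v = a i :> R^o.
  have : range f (a i); last by case=> v _ <-; exists v.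
  rewrite fI; exists (fun j => (j == enum_rank i)%:R).
  rewrite (bigD1 (enum_rank i)) //= eqxx scale1r /a' enum_rankK big1 ?addr0 //.
  by move=> j /negbTE ->; rewrite scale0r.
have /choice[v vP] l : exists w : I -> R, f (delta_mx 0 l) = \sum_i w i * a i :> R.
  have : range f (f (delta_mx 0 l)) by exists (delta_mx 0 l).
  rewrite {1}fI => -[c ->]; exists (c \o enum_rank).
  by rewrite sumE; apply: eq_bigr => i _; rewrite /a' enum_rankK.
pose V (w : 'rV[R]_p) i := \sum_l w 0 l * v l i.
have fV w : f w = \sum_i V w i * a i :> R.
  rewrite {1}[w]row_sum_delta raddf_sum /V /=.
  under [RHS]eq_bigr do rewrite mulr_suml.
  rewrite exchange_big /=; apply: eq_bigr => l _.
  rewrite linearZ /= vP /GRing.scale /= mulr_sumr.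
  by apply: eq_bigr => i _; rewrite mulrA.
(* Two kinds of relations: the generators of the kernel of [f], rewritten by [V], and the difference
   between the unit vector at [k] and [V (u k)], which both represent [a k]. *)
exists ('I_q + I)%type, (fun j i => match j with
  | inl l => V (kappa l) i | inr k => (i == k)%:R - V (u k) i end).
split=> [[l|k]|c c0].
- rewrite -fV; have : [set v | f v = 0] (kappa l); last by [].
  rewrite kerE; exists (fun k => (k == l)%:R).
  rewrite (bigD1 l) //= eqxx scale1r big1 ?addr0 //.
  by move=> j /negbTE ->; rewrite scale0r.
- under eq_bigr do rewrite mulrBl; rewrite sumrB -fV uP (bigD1 k) //= eqxx mul1r.
  by rewrite big1 ?addr0 ?subrr // => i /negbTE ->; rewrite mul0r.
have : [set v | f v = 0] (\sum_i c i *: u i).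
  rewrite /= raddf_sum -[RHS]c0; apply: eq_bigr => i _.
  by rewrite /= linearZ /= uP.
rewrite kerE => -[e eE].
exists (fun j => match j with inl l => e l | inr k => c k end) => i.
have Vlin (T : finType) (t : T -> R) (w : T -> 'rV[R]_p) :
    V (\sum_x t x *: w x) i = \sum_x t x * V (w x) i.
  rewrite /V; under [RHS]eq_bigr do rewrite mulr_sumr.
  rewrite exchange_big; apply: eq_bigr => l _ /=.
  rewrite summxE mulr_suml; apply: eq_bigr => x _.
  by rewrite mxE mulrA.
rewrite big_sumType /= -Vlin -eE Vlin -big_split /= (bigD1 i) //= eqxx big1.
  by rewrite mulrBr mulr1 addr0 addrC subrK.
by move=> k ki; rewrite eq_sym (negbTE ki) sub0r mulrN addrN.
Qed.

Section DualOfInjective.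
Variable R : comPzRingType.

(** Let T : Q^I -> Q^J be given by generating relations [b] of [a]. Injectivity of Q shows that
    every x in the kernel of T has the form [x i = a i *: q], so the family [g] kills it. As E is
    injective, [g] factors through T, and the components of the factor trivialise the relation. *)
Lemma coherent_dual_eqflat (E Q : lmodType R) : coherent_ring R ->
  extends_maps E -> extends_maps Q -> eqflat (dual E Q).
Proof.
move=> Rcoh Eext Qext I a g ag0.
have [J [b [ba0 bgen]]] := coherent_relations Rcoh a.
have Tl : linear (fun x : I -> Q => fun j => \sum_i b j i *: x i).
  by move=> c x y; apply/funext => j; rewrite !fctE -linear_comb_linear.
have fl : linear (fun x : I -> Q => \sum_i dual_fun (g i) (x i)).
  move=> c x y; rewrite scaler_sumr -big_split /=; apply: eq_bigr => i _.
  by rewrite linearP.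
have [x Tx0|h hP] := Eext _ _ (linear_pack Tl) (linear_pack fl).
  (* The map sending [c] to the sum of [c i *: x i] vanishes on all relations of [a], so it factors
     through the sum of [c i * a i] by a map [k]; the element q is [k 1]. *)
  have cl : linear (fun c : I -> R^o => \sum_i (c i : R) *: x i).
    move=> r c d; rewrite scaler_sumr -big_split /=; apply: eq_bigr => i _.
    by rewrite !fctE scalerDl scalerA.
  have al : linear (fun c : I -> R^o => \sum_i (c i : R) * a i : R^o).
    move=> r c d; rewrite scaler_sumr -big_split /=; apply: eq_bigr => i _.
    by rewrite !fctE mulrDl /GRing.scale /= mulrA.
  have [c /= /bgen[e eE]|k kP] := Qext _ _ (linear_pack al) (linear_pack cl).
    under eq_bigr do rewrite eE scaler_suml.
    rewrite exchange_big big1 //= => j _.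
    under eq_bigr do rewrite -scalerA.
    rewrite -scaler_sumr; have := congr1 (fun w => w j) Tx0.
    by rewrite /= => ->; rewrite scaler0.
  have xE i : x i = a i *: k 1.
    have := kP (single i (1 : R^o)).
    rewrite /= (bigD1 i) //= /single eqxx mul1r big1 ?addr0.
      rewrite (bigD1 i) //= eqxx scale1r big1 ?addr0 => [<-|j /negbTE ->];
        last exact: scale0r.
      by rewrite -linearZ /GRing.scale /= mulr1.
    by move=> j /negbTE ->; rewrite mul0r.
  rewrite /=; transitivity (dual_fun (\sum_i a i *: g i) (k 1)); last first.
    by rewrite ag0 dual_fun0.
  by rewrite dual_fun_sum; apply: eq_bigr => i _; rewrite xE dual_funZ !linearZ.
have hl j : linear (fun q => h (single j q)).
  by move=> c x y; rewrite single_linear linearP.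
exists J, (fun i j => b j i), (fun j => dual_pack (hl j)); split=> [i|j]; last first.
  by under eq_bigr do rewrite mulrC; exact: ba0.
apply: dualP => q.
have := hP (single i q); rewrite /= linear_sum_single /= => hq.
transitivity (\sum_i0 dual_fun (g i0) (single i q i0)).
  rewrite (bigD1 i) //= /single eqxx big1 ?addr0 // => j /negbTE ->.
  by rewrite raddf0.
rewrite -hq dual_fun_sum.
apply: eq_bigr => j _; rewrite (bigD1 i) //= /single eqxx big1 ?addr0.
  by rewrite -!/(single _ _) singleZ linearZ dual_funZ.
by move=> l /negbTE ->; exact: scaler0.
Qed.

End DualOfInjective.

(** * The bidual coresolution *)

(** Purity is stated through systems of linear equations: every finitely
    presented module maps to the complex exactly. *)
Record pure_coresolution (R : comPzRingType) := PureCoresolution {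
  pc_obj :> nat -> lmodType R;
  pc_d : forall k, {linear pc_obj k -> pc_obj k.+1};
  pc_dd : forall k x, pc_d k.+1 (pc_d k x) = 0;
  pc_inj : injective (pc_d 0);
  pc_pure : forall k (I J : finType) (A : J -> I -> R) (y : I -> pc_obj k.+1),
    (forall i, pc_d k.+1 (y i) = 0) -> (forall j, \sum_i A j i *: y i = 0) ->
    exists x : I -> pc_obj k,
      (forall i, pc_d k (x i) = y i) /\ (forall j, \sum_i A j i *: x i = 0)
}.

Section Bidual.
Variables (R : comPzRingType) (E : lmodType R).
Hypotheses (Eext : extends_maps E) (Ecog : cogenerator E).

Definition bidual (F : lmodType R) : lmodType R := dual E (dual E F).

Section ToBidual.
Variable F : lmodType R.

Definition to_bidual (x : F) : bidual F := dual_pack (@dual_eval_linear R E F x).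

Lemma to_bidual_linear : linear to_bidual.
Proof.
by move=> a x y; apply: dualP => f; rewrite dual_funP; exact: (dual_fun_linear f).
Qed.

HB.instance Definition _ := GRing.isLinear.Build R F (bidual F) *:%R to_bidual
  to_bidual_linear.

Lemma to_bidual_eval x f : dual_fun (to_bidual x) f = dual_fun f x.
Proof. by []. Qed.

Lemma to_bidual_inj : injective to_bidual.
Proof.
move=> x y exy; have [//|nxy] := pselect (x = y).
have [|f []] := @Ecog F (x - y); first by move/eqP; rewrite subr_eq0 => /eqP.
have fyx : f y = f x.
  by have := to_bidual_eval x (dual_pack (linearP f)); rewrite exy to_bidual_eval.
by rewrite raddfB /= fyx subrr.
Qed.

(** If [z] were not in the image of the system over [F], the cogenerator would give a functional on
    F^J vanishing on that image but not at [z]. Its components [theta] satisfy the transposed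
    homogeneous system, so the solution [y] in the bidual forces its value at [z] to be zero. *)
Lemma to_bidual_pure (I J : finType) (A : J -> I -> R) (y : I -> bidual F)
    (z : J -> F) :
  (forall j, \sum_i A j i *: y i = to_bidual (z j)) ->
  exists x : I -> F, forall j, \sum_i A j i *: x i = z j.
Proof.
move=> yz.
pose S (w : J -> F) := exists x : I -> F, forall j, \sum_i A j i *: x i = w j.
have Scl : S 0 /\ forall a v w, S v -> S w -> S (a *: v + w).
  split; first by exists 0 => j; apply: big1 => i _; exact: scaler0.
  move=> a v w [x xE] [x' xE']; exists (a *: x + x') => j.
  by rewrite linear_comb_linear xE xE'.
have [//|nSz] := pselect (S z).
have [|f] := @Ecog _ (quot_pi (Submodule Scl) z); first by move/quot_pi_eq0.
case; have tl j : linear (fun v : F => f (quot_pi (Submodule Scl) (single j v))).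
  by move=> a u v; rewrite single_linear !linearP.
pose theta j := dual_pack (tl j).
have thetaE w : f (quot_pi (Submodule Scl) w) = \sum_j dual_fun (theta j) (w j).
  by rewrite {1}[w]sum_single !raddf_sum.
rewrite thetaE; under eq_bigr do rewrite -to_bidual_eval -yz dual_fun_sum.
rewrite exchange_big big1 //= => i _.
under eq_bigr do rewrite dual_funZ -linearZ.
rewrite -raddf_sum /=; have -> : \sum_j A j i *: theta j = 0; last by rewrite raddf0.
apply: dualP => x; rewrite dual_fun_sum dual_fun0.
under eq_bigr do rewrite dual_funZ -linearZ.
rewrite -thetaE; have /quot_pi_eq0-> : Submodule Scl (fun j => A j i *: x).
  exists (single i x) => j.
  rewrite (bigD1 i) //= /single eqxx big1 ?addr0 // => k /negbTE ->.
  exact: scaler0.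
by rewrite raddf0.
Qed.

Lemma to_bidual_range_closed : (exists x, to_bidual x = 0) /\ forall a u v,
  (exists x, to_bidual x = u) -> (exists x, to_bidual x = v) ->
  exists x, to_bidual x = a *: u + v.
Proof.
split; first by exists 0; rewrite raddf0.
by move=> a _ _ [x <-] [y <-]; exists (a *: x + y); rewrite linearP.
Qed.

Definition cobidual : lmodType R :=
  quot_mod (@Submodule R (bidual F) (fun u => exists x, to_bidual x = u)
    to_bidual_range_closed).

Definition cobidual_pi : {linear bidual F -> cobidual} :=
  linear_pack (@quot_pi_linear _ _ _).

Lemma cobidual_pi_surj v : exists u, cobidual_pi u = v.
Proof. exact: quot_pi_surj. Qed.

Lemma cobidual_pi_eq0 u : cobidual_pi u = 0 <-> exists x, to_bidual x = u.
Proof. exact: quot_pi_eq0. Qed.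

(** Arbitrary lifts satisfy the equations up to elements of [F]; purity solves the resulting system
    inside [F], and subtracting that solution corrects the lifts. *)
Lemma cobidual_lift (I J : finType) (A : J -> I -> R) (v : I -> cobidual) :
  (forall j, \sum_i A j i *: v i = 0) ->
  exists y : I -> bidual F,
    (forall i, cobidual_pi (y i) = v i) /\ (forall j, \sum_i A j i *: y i = 0).
Proof.
move=> v0; have /choice[y yP] i := cobidual_pi_surj (v i).
have /choice[z zP] j : exists x, to_bidual x = \sum_i A j i *: y i.
  apply/cobidual_pi_eq0; rewrite raddf_sum -[RHS](v0 j).
  by apply: eq_bigr => i _; rewrite /= linearZ yP.
have [|x xP] := @to_bidual_pure I J A y z; first by move=> j; rewrite zP.
exists (fun i => y i - to_bidual (x i)); split=> [i|j].
  have /cobidual_pi_eq0 pix : exists x', to_bidual x' = to_bidual (x i).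
    by exists (x i).
  by rewrite linearB (yP i) pix subr0.
under eq_bigr do rewrite scalerBr -linearZ.
by rewrite sumrB -zP -xP raddf_sum subrr.
Qed.

End ToBidual.

Lemma cobidual_eqflat F : eqflat (bidual F) -> eqflat (cobidual F).
Proof.
move=> Gflat I a g ag0.
have [|y [yg ay0]] := @cobidual_lift F I unit (fun _ i => a i) g; first by [].
have [J [b [h [yE ab0]]]] := Gflat I a y (ay0 tt).
exists J, b, (fun j => cobidual_pi F (h j)); split=> // i.
by rewrite -yg yE raddf_sum; apply: eq_bigr => j _; rewrite /= linearZ.
Qed.

Lemma bidual_eqflat F : coherent_ring R -> eqflat F -> eqflat (bidual F).
Proof.
by move=> Rcoh Fflat; apply: coherent_dual_eqflat => //; exact: eqflat_dual_extends.
Qed.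

Section Coresolution.
Variable Q : lmodType R.

Fixpoint cosyzygy (k : nat) : lmodType R :=
  match k with 0 => Q | k.+1 => cobidual (cosyzygy k) end.

(** Degree 0 is [Q] itself and the bidual of the k-th cosyzygy stands in degree k + 1, so the
    complex is exact at [Q] too. *)
Definition bidual_res (k : nat) : lmodType R :=
  match k with 0 => Q | k.+1 => bidual (cosyzygy k) end.

Definition bidual_proj k : {linear bidual_res k -> cosyzygy k} :=
  match k with 0 => idfun | k.+1 => cobidual_pi (cosyzygy k) end.

Definition bidual_d k (x : bidual_res k) : bidual_res k.+1 :=
  to_bidual (bidual_proj k x).

Lemma bidual_d_linear k : linear (@bidual_d k).
Proof. by move=> a x y; rewrite /bidual_d !linearP. Qed.

(** Cycles in degree k + 1 form the embedded k-th cosyzygy. The equations hold there by injectivity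
    of the embedding, and then lift along [bidual_proj]. *)
Lemma bidual_pure k (I J : finType) (A : J -> I -> R) (y : I -> bidual_res k.+1) :
    (forall i, bidual_d (y i) = 0) -> (forall j, \sum_i A j i *: y i = 0) ->
  exists x : I -> bidual_res k,
    (forall i, bidual_d (x i) = y i) /\ (forall j, \sum_i A j i *: x i = 0).
Proof.
move=> dy0 Ay0; have /choice[u uP] i : exists u, to_bidual u = y i.
  by apply/cobidual_pi_eq0/to_bidual_inj; rewrite raddf0; exact: dy0.
have Au0 j : \sum_i A j i *: u i = 0.
  apply: to_bidual_inj; rewrite raddf0 raddf_sum -[RHS](Ay0 j).
  apply: eq_bigr => i _.
  by rewrite /= linearZ /= uP.
have [x [xu Ax0]] : exists x : I -> bidual_res k,
    (forall i, bidual_proj k (x i) = u i) /\ (forall j, \sum_i A j i *: x i = 0).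
  by case: k y u Au0 {dy0 Ay0 uP} => [y u Au0|k y u /cobidual_lift//]; exists u.
by exists x; split=> // i; rewrite /bidual_d xu.
Qed.

Lemma bidual_dd k x : bidual_d (@bidual_d k x) = 0.
Proof.
rewrite /bidual_d -(raddf0 (@to_bidual _)); congr to_bidual.
by apply/cobidual_pi_eq0; exists (bidual_proj k x).
Qed.

Definition bidual_coresolution : pure_coresolution R :=
  @PureCoresolution R bidual_res (fun k => linear_pack (@bidual_d_linear k))
    bidual_dd (@to_bidual_inj Q) bidual_pure.

End Coresolution.

End Bidual.

(** * Null homotopies into pure exact complexes *)

Lemma dep_choice (I : Type) (T : I -> Type) (P : forall i, T i -> Prop) :
  (forall i, exists x, P i x) -> exists f : forall i, T i, forall i, P i (f i).
Proof.
by move=> /(_ _)/cid f; exists (fun i => sval (f i)) => i; exact: svalP (f i).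
Qed.

Lemma eq_sum_uniq (V : zmodType) (X : eqType) (s t : seq X) (F : X -> V) :
    uniq s -> uniq t ->
    (forall x, x \in s -> x \notin t -> F x = 0) ->
    (forall x, x \in t -> x \notin s -> F x = 0) ->
  \sum_(x <- s) F x = \sum_(x <- t) F x.
Proof.
move=> us ut s0 t0.
have half (r q : seq X) : (forall x, x \in r -> x \notin q -> F x = 0) ->
    \sum_(x <- r) F x = \sum_(x <- [seq x <- r | x \in q]) F x.
  move=> r0; rewrite big_filter (bigID (mem q)) /= [X in _ + X]big_seq_cond.
  by rewrite [X in _ + X]big1 ?addr0 // => x /andP[]; exact: r0.
rewrite (half s t) // (half t s) //; apply: perm_big; apply: uniq_perm.
- exact: filter_uniq.
- exact: filter_uniq.
- by move=> x; rewrite !mem_filter andbC.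
Qed.

(** * Linear combinations with finitely supported coefficients *)

Section WeightedSums.
Variables (R : comPzRingType) (X : choiceType).
Implicit Types (a b : X -> R) (V : lmodType R).

Definition finite_supp a : Prop := exists s : seq X, forall x, x \notin s -> a x = 0.

(** A chosen list outside which [a] vanishes, possibly containing zeros of [a], and empty if there
    is none. Thus [wsum] takes no proof of finiteness. *)
Definition fsupp a : seq X :=
  undup (xget [::] [set s : seq X | forall x, x \notin s -> a x = 0]).

Lemma fsuppP a x : finite_supp a -> x \notin fsupp a -> a x = 0.
Proof.
by case=> s sP; rewrite mem_undup; case: xgetP => [t _ tP|/(_ s)//]; exact: tP.
Qed.

(** For [a] of finite support, this is the linear extension of [u] to the free module on [X],
    evaluated at the element with coordinates [a]. *)
Definition wsum V a (u : X -> V) : V := \sum_(x <- fsupp a) a x *: u x.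

Lemma wsum_seq V a (u : X -> V) (s : seq X) : finite_supp a -> uniq s ->
  (forall x, x \notin s -> a x *: u x = 0) -> wsum a u = \sum_(x <- s) a x *: u x.
Proof.
move=> afin us s0; apply: eq_sum_uniq => //; first exact: undup_uniq.
  by move=> x _; exact: s0.
by move=> x _ /(fsuppP afin) ->; rewrite scale0r.
Qed.

Lemma eq_wsum V a (u v : X -> V) :
  (forall x, a x *: u x = a x *: v x) -> wsum a u = wsum a v.
Proof. by move=> uv; apply: eq_bigr => x _. Qed.

Lemma wsum0 V a (u : X -> V) : (forall x, a x *: u x = 0) -> wsum a u = 0.
Proof. by move=> u0; apply: big1 => x _. Qed.

Lemma wsumD V a (u v : X -> V) : wsum a (fun x => u x + v x) = wsum a u + wsum a v.
Proof. by rewrite -big_split; apply: eq_bigr => x _; rewrite scalerDr. Qed.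

Lemma wsumB V a (u v : X -> V) : wsum a (fun x => u x - v x) = wsum a u - wsum a v.
Proof. by rewrite -sumrB; apply: eq_bigr => x _; rewrite scalerBr. Qed.

Lemma wsum_map V (W : lmodType R) (f : {linear V -> W}) a (u : X -> V) :
  f (wsum a u) = wsum a (fun x => f (u x)).
Proof. by rewrite raddf_sum; apply: eq_bigr => x _; rewrite /= linearZ. Qed.

Lemma finite_suppD c a b :
  finite_supp a -> finite_supp b -> finite_supp (fun x => c * a x + b x).
Proof.
move=> [s sP] [t tP]; exists (s ++ t) => x; rewrite mem_cat negb_or => /andP[xs xt].
by rewrite sP // tP // mulr0 addr0.
Qed.

Lemma wsum_linear V c a b (u : X -> V) : finite_supp a -> finite_supp b ->
  wsum (fun x => c * a x + b x) u = c *: wsum a u + wsum b u.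
Proof.
move=> afin bfin.
have abfin := finite_suppD c afin bfin.
have us : uniq (undup (fsupp a ++ fsupp b)) by exact: undup_uniq.
have s0 x : x \notin undup (fsupp a ++ fsupp b) -> a x = 0 /\ b x = 0.
  by rewrite mem_undup mem_cat negb_or => /andP[/(fsuppP afin) -> /(fsuppP bfin)].
rewrite !(wsum_seq (s := undup (fsupp a ++ fsupp b))) //.
- rewrite scaler_sumr -big_split; apply: eq_bigr => x _.
  by rewrite /= scalerDl scalerA.
all: by move=> x /s0[a0 b0]; rewrite ?a0 ?b0 ?mulr0 ?addr0 scale0r.
Qed.

Definition unit_weight (x : X) : X -> R := fun y => (y == x)%:R.

Lemma finite_supp_unit x : finite_supp (unit_weight x).
Proof. by exists [:: x] => y; rewrite inE /unit_weight => /negbTE ->. Qed.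

Lemma wsum_unit V x (u : X -> V) : wsum (unit_weight x) u = u x.
Proof.
rewrite (wsum_seq (s := [:: x])) //; last 2 first.
- exact: finite_supp_unit.
- by move=> y; rewrite inE /unit_weight => /negbTE ->; rewrite scale0r.
by rewrite big_seq1 /unit_weight eqxx scale1r.
Qed.

End WeightedSums.

Section NullHomotopy.
Variables (R : comPzRingType) (X : pure_coresolution R).
(** A complex of free modules with raising differential, given by bases [B k] and the coordinates
    [D b] of the differential of [b]. That it squares to zero is expressed by [DD] through test maps
    [s]. *)
Variables (B : nat -> choiceType) (D : forall k, B k -> B k.+1 -> R).
Hypothesis Dfin : forall k (b : B k), finite_supp (D b).
Hypothesis DD : forall (V : lmodType R) k (b : B k) (s : B k.+2 -> V),
  wsum (D b) (fun c => wsum (D c) s) = 0.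

Local Notation d := (@pc_d R X _).

(** Purity for one unknown and no equations. *)
Lemma pc_exact k (y : X k.+1) : d y = 0 -> exists x : X k, d x = y.
Proof.
move=> dy; have [|[]|x [xy _]] := @pc_pure R X k unit void (fun=> fun=> 0) (fun=> y).
- by [].
- by exists (x tt).
Qed.

(** The Zorn step: [K] is a subcomplex of the quotient
    of the free complex by the span of [A], finite in each degree, and [r]
    a chain map vanishing on [A]. *)
Section FiniteStep.
Variables (A : forall k, B k -> Prop) (K : forall k, seq (B k)).
Arguments A {k}.
Hypothesis Kuniq : forall k, uniq (K k).
Hypothesis AD : forall k (b : B k) c, A b -> D b c <> 0 -> A c.
Hypothesis KA : forall k (b : B k), b \in K k -> ~ A b.
Hypothesis KD : forall k (b : B k) c, b \in K k -> D b c <> 0 -> A c \/ c \in K k.+1.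
Variable r : forall k, B k -> X k.
Hypothesis rA : forall k (b : B k), A b -> r b = 0.
Hypothesis rD : forall k (b : B k), d (r b) = wsum (D b) (@r k.+1).

Definition supported_on (V : lmodType R) k (u : B k -> V) : Prop :=
  forall b, b \notin K k -> u b = 0.

Lemma eq_wsumK (V : lmodType R) k (b : B k) (u v : B k.+1 -> V) : b \in K k ->
  (forall c, A c -> u c = v c) -> (forall c, c \in K k.+1 -> u c = v c) ->
  wsum (D b) u = wsum (D b) v.
Proof.
move=> Kb uvA uvK; apply: eq_wsum => c.
have [->|/eqP Dbc] := eqVneq (D b c) 0; first by rewrite !scale0r.
by have [/uvA ->|/uvK ->] := KD Kb Dbc.
Qed.

Lemma supported_A (V : lmodType R) k (u : B k -> V) b :
  supported_on u -> A b -> u b = 0.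
Proof. by move=> uK Ab; apply: uK; apply/negP => /KA. Qed.

Lemma wsum_A (V : lmodType R) k (u : B k.+1 -> V) (b : B k) :
  supported_on u -> A b -> wsum (D b) u = 0.
Proof.
move=> uK Ab; apply: wsum0 => c.
have [->|/eqP Dbc] := eqVneq (D b c) 0; first by rewrite scale0r.
by rewrite (supported_A uK) ?scaler0 //; exact: AD Ab Dbc.
Qed.

Lemma lift_K j k (y : B k -> X j.+1) : (forall b, b \in K k -> d (y b) = 0) ->
  exists2 x : B k -> X j, supported_on x & forall b, b \in K k -> d (x b) = y b.
Proof.
move=> dy; have /choice[x xP] b : exists e : X j,
    (b \notin K k -> e = 0) /\ (b \in K k -> d e = y b).
  have [Kb|] := boolP (b \in K k); last by exists 0.
  by have [e eP] := pc_exact (dy b Kb); exists e.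
by exists x => b; case: (xP b).
Qed.

(** The last hypothesis makes [y] a map from the cokernel of the differential from [K k] to
    [K k.+1], which is finitely presented. In the linear system the unknowns are the positions in
    [K k.+1] and the equations the elements of [K k]. *)
Lemma pure_lift_K j k (y : B k.+1 -> X j.+1) :
  (forall b, b \in K k.+1 -> d (y b) = 0) -> supported_on y ->
  (forall a, a \in K k -> wsum (D a) y = 0) ->
  exists x : B k.+1 -> X j, [/\ supported_on x,
    forall b, b \in K k.+1 -> d (x b) = y b &
    forall a, a \in K k -> wsum (D a) x = 0].
Proof.
move=> dy yK Dy; pose e := tnth (in_tuple (K k.+1)).
have sumK (V : lmodType R) (u : B k.+1 -> V) a : supported_on u ->
    wsum (D a) u = \sum_i D a (e i) *: u (e i).
  move=> uK; transitivity (\sum_(c <- K k.+1) D a c *: u c); last exact: big_tnth.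
  by apply: wsum_seq => // b /uK ->; exact: scaler0.
have [i|[a Ka]|x [xy Dx]] := @pc_pure R X j 'I_(size (K k.+1)) (seq_sub (K k))
    (fun a i => D (val a) (e i)) (fun i => y (e i)).
- by apply: dy; exact: mem_tnth.
- by rewrite -sumK //; exact: Dy.
have /choice[z zP] b : exists v : X j,
    (b \notin K k.+1 -> v = 0) /\ (forall i, b = e i -> v = x i).
  have [/(tnthP (in_tuple (K k.+1)))[i bi]|Kb] := boolP (b \in K k.+1); last first.
    by exists 0; split=> // i bi; rewrite bi mem_tnth in Kb.
  exists (x i); split=> // i'; rewrite bi => /eqP.
  by rewrite /e !(tnth_nth b) /= nth_uniq // => /eqP/val_inj ->.
have zK : supported_on z by move=> b; case: (zP b).
have ze i : z (e i) = x i by case: (zP (e i)) => _; apply.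
exists z; split=> // [b /(tnthP (in_tuple (K k.+1)))[i ->]|a Ka].
  by rewrite ze xy.
rewrite sumK //; under eq_bigr do rewrite ze.
exact: Dx (SeqSub Ka).
Qed.

Let cut (V : lmodType R) k (u : B k -> V) b : V := if b \in K k then u b else 0.

(** Purity is used twice: [t] lifts [d r] and kills the image of [D], so that
    [s] with [d s = r - t] leaves the error [g = t - s D], which also kills the
    image of [D] and lifts to [h]; the homotopy is [s + h]. *)
Lemma finite_null_homotopy : exists sigma : forall k, B k.+1 -> X k,
  [/\ forall k, supported_on (sigma k),
      forall b : B 0, b \in K 0 -> r b = wsum (D b) (sigma 0) &
      forall k (b : B k.+1), b \in K k.+1 ->
        r b = d (sigma k b) + wsum (D b) (sigma k.+1)].
Proof.
have cutE (V : lmodType R) k (u : B k -> V) b : b \in K k -> cut u b = u b.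
  by rewrite /cut => ->.
have cutK (V : lmodType R) k (u : B k -> V) : supported_on (cut u).
  by move=> b; rewrite /cut => /negbTE ->.
have cutA (V : lmodType R) k (u : B k -> V) b : A b -> cut u b = 0.
  by move=> Ab; apply: cutK; apply/negP => /KA.
have /dep_choice[t tP] k : exists t : B k.+1 -> X k.+1, [/\ supported_on t,
    forall b, b \in K k.+1 -> d (t b) = d (r b) &
    forall a, a \in K k -> wsum (D a) t = 0].
  have [b Kb||a Ka|t [tK tr Dt]] := @pure_lift_K k.+1 k (cut (fun b => d (r b))).
  - by rewrite cutE // pc_dd.
  - exact: cutK.
  - rewrite (@eq_wsumK _ _ a _ (fun c => d (r c))) //.
    + by rewrite -wsum_map -rD pc_dd.
    + by move=> c Ac; rewrite cutA // rA // raddf0.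
    + by move=> c; exact: cutE.
  by exists t; split=> // b Kb; rewrite tr // cutE.
have /dep_choice[s sP] k : exists s : B k.+1 -> X k, supported_on s /\
    forall b, b \in K k.+1 -> d (s b) = r b - t k b.
  have [tK tr _] := tP k.
  have [b Kb|s sK sE] := @lift_K k k.+1 (fun b => r b - t k b).
    by rewrite raddfB /= tr // subrr.
  by exists s.
have Ds k (a : B k) : a \in K k -> wsum (D a) (fun b => d (s k b)) = d (r a).
  move=> Ka; have [tK _ Dt] := tP k; have [sK sE] := sP k.
  rewrite (@eq_wsumK _ _ a _ (fun b => r b - t k b)) // => [|c Ac].
  - by rewrite wsumB Dt // subr0 rD.
  - by rewrite (supported_A sK) // (supported_A tK) // rA // raddf0 subr0.
have /dep_choice[h hP] k : exists h : B k.+1 -> X k, [/\ supported_on h,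
    forall b, b \in K k.+1 -> d (h b) = t k b - wsum (D b) (s k.+1) &
    forall a, a \in K k -> wsum (D a) h = 0].
  have [tK tr Dt] := tP k; have [sK _] := sP k.+1.
  have [b Kb||a Ka|h [hK hg Dh]] :=
      @pure_lift_K k k (cut (fun b => t k b - wsum (D b) (s k.+1))).
  - by rewrite cutE // raddfB /= wsum_map Ds // tr // subrr.
  - exact: cutK.
  - rewrite (@eq_wsumK _ _ a _ (fun b => t k b - wsum (D b) (s k.+1))) //.
    + by rewrite wsumB Dt // DD subr0.
    + by move=> c Ac; rewrite cutA // (supported_A tK) // wsum_A // subr0.
    + by move=> c; exact: cutE.
  by exists h; split=> // b Kb; rewrite hg // cutE.
exists (fun k b => s k b + h k b); split=> [k b Kb|b Kb|k b Kb].
- by have [-> // _] := sP k; have [-> // _ _] := hP k; rewrite addr0.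
(* Nothing maps into degree 0 of [X], so the equation left for [s] is checked after the injective
   first differential. *)
- have [_ _ Dh] := hP 0; rewrite wsumD Dh // addr0; apply: (@pc_inj R X).
  by rewrite wsum_map Ds.
have [_ _ Dh] := hP k.+1; have [_ dh _] := hP k; have [_ ds] := sP k.
rewrite wsumD Dh // addr0 raddfD /= ds // dh //.
by rewrite addrA !subrK.
Qed.

End FiniteStep.

Variable f : forall k, B k -> X k.
Hypothesis fD : forall k (b : B k), d (f b) = wsum (D b) (@f k.+1).

(** The failure of [s] to be a null homotopy of [f], again a chain map by [residualD], so that the
    finite step applies to it. *)
Definition residual (s : forall k, B k.+1 -> X k) k : B k -> X k :=
  match k with
  | 0 => fun b => f b - wsum (D b) (s 0)
  | k.+1 => fun b => f b - (d (s k b) + wsum (D b) (s k.+1))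
  end.

Lemma residualD s k (b : B k) :
  d (residual s b) = wsum (D b) (residual s (k := k.+1)).
Proof.
have E : wsum (D b) (residual s (k := k.+1)) =
    d (f b) - wsum (D b) (fun c => d (s k c)).
  by rewrite /residual wsumB wsumD DD addr0 fD.
rewrite {}E; case: k b => [|k] b /=; rewrite raddfB /= ?raddfD /= ?wsum_map //.
by rewrite pc_dd oppr0 add0r.
Qed.

(** The domain spans a subcomplex; [ph_fun] is a total function with arbitrary values outside it. *)
Record partial_homotopy := PartialHomotopy {
  ph_dom : forall k, B k -> Prop;
  ph_fun : forall k, B k.+1 -> X k;
  ph_domD : forall k (b : B k) c, ph_dom b -> D b c <> 0 -> ph_dom c;
  ph_res : forall k (b : B k), ph_dom b -> residual ph_fun b = 0
}.
Arguments ph_dom p {k} b.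
Arguments ph_fun p {k} b.

Lemma residual_local (A : forall k, B k -> Prop) (s s' : forall k, B k.+1 -> X k) :
  (forall k (b : B k) c, A k b -> D b c <> 0 -> A k.+1 c) ->
  (forall k c, A k.+1 c -> s k c = s' k c) ->
  forall k b, A k b -> residual s b = residual s' b.
Proof.
move=> AD ss'.
have ws k b : A k b -> wsum (D b) (s k) = wsum (D b) (s' k).
  move=> Ab; apply: eq_wsum => c.
  have [->|/eqP Dbc] := eqVneq (D b c) 0; first by rewrite !scale0r.
  by rewrite ss' //; exact: AD Ab Dbc.
by case=> [|k] b Ab /=; rewrite ws // ss'.
Qed.

Definition ph_le (p q : partial_homotopy) : bool :=
  `[< (forall k (b : B k), ph_dom p b -> ph_dom q b) /\
      (forall k (c : B k.+1), ph_dom p c -> ph_fun q c = ph_fun p c) >].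

Lemma ph_refl p : ph_le p p.
Proof. exact/asboolP. Qed.

Lemma ph_trans p q r : ph_le p q -> ph_le q r -> ph_le p r.
Proof.
move=> /asboolP[pq spq] /asboolP[qr sqr]; apply/asboolP; split=> k b pb.
  by apply: qr; apply: pq.
by rewrite sqr ?spq //; exact: pq.
Qed.

Lemma ph_chain (F : set partial_homotopy) : total_on F ph_le ->
  exists t, forall s, F s -> ph_le s t.
Proof.
move=> Ftot; pose S k (b : B k) := exists2 p, F p & ph_dom p b.
have /dep_choice[s sP] k : exists s : B k.+1 -> X k,
    forall p c, F p -> ph_dom p c -> s c = ph_fun p c.
  suff /choice[s sP] (c : B k.+1) :
      exists v : X k, forall p, F p -> ph_dom p c -> v = ph_fun p c.
    by exists s => p c; exact: sP.
  have [[p Fp pc]|nSc] := pselect (S _ c); last first.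
    by exists 0 => p Fp pc; case: nSc; exists p.
  exists (ph_fun p c) => q Fq qc.
  by have [/asboolP[_ ->]|/asboolP[_ ->]] := Ftot p q Fp Fq.
have SD k (b : B k) c : S k b -> D b c <> 0 -> S k.+1 c.
  by move=> [p Fp pb] Dbc; exists p => //; exact: ph_domD pb Dbc.
have Sres k (b : B k) : S k b -> residual s b = 0.
  move=> [p Fp pb]; rewrite -(ph_res pb).
  apply: (@residual_local (@ph_dom p)) pb => [|j c pc]; first exact: ph_domD.
  exact: sP.
exists (PartialHomotopy SD Sres) => p Fp; apply/asboolP; split=> k b pb /=.
  by exists p.
exact: sP.
Qed.

(** The differential raises the degree and has finite supports, so adding the supports outside [A]
    degree by degree keeps each degree finite, although infinitely many degrees may be reached. *)
Lemma finite_closure (A : forall k, B k -> Prop) N (b0 : B N) : ~ A N b0 ->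
  exists K : forall k, seq (B k), [/\ b0 \in K N, forall k, uniq (K k),
    forall k b, b \in K k -> ~ A k b &
    forall k (b : B k) c, b \in K k -> D b c <> 0 -> A k.+1 c \/ c \in K k.+1].
Proof.
move=> Ab0; pose start k : seq (B k) :=
  if N =P k is ReflectT e then [:: eq_rect N B b0 k e] else [::].
have startA k b : b \in start k -> ~ A k b.
  by rewrite /start; case: eqP => // e; case: k / e b => b; rewrite inE => /eqP ->.
have b0_start : b0 \in start N.
  by rewrite /start; case: eqP => // e; rewrite (eq_axiomK e) inE.
pose next k (l : seq (B k)) :=
  [seq c <- flatten [seq fsupp (D b) | b <- l] | ~~ `[< A k.+1 c >]].
pose K := fix K k : seq (B k) := match k with
  0 => undup (start 0) | k.+1 => undup (start k.+1 ++ next k (K k)) end.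
exists K; split.
- by case: N b0 {Ab0} @start @next @K startA b0_start => [|N] b0 start next K _;
    rewrite mem_undup // mem_cat => ->.
- by case=> [|k]; exact: undup_uniq.
- case=> [|k] b; rewrite mem_undup; first exact: startA.
  by rewrite mem_cat mem_filter => /orP[/startA//|/andP[/asboolPn]].
- move=> k b c Kb Dbc; have [Ac|nAc] := pselect (A _ c); [by left | right].
  rewrite /= mem_undup mem_cat mem_filter; apply/orP; right.
  apply/andP; split; first exact/asboolPn.
  apply/flattenP; exists (fsupp (D b)); first exact: map_f.
  by apply/negPn/negP => /(fsuppP (Dfin b)).
Qed.

Lemma null_homotopy : exists s : B 1 -> X 0, forall b : B 0, f b = wsum (D b) s.
Proof.
have S0D k (b : B k) (c : B k.+1) : False -> D b c <> 0 -> False by [].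
have S0res k (b : B k) : False -> residual (fun _ _ => 0) b = 0 by [].
have [p pmax] := ZL_preorder (PartialHomotopy S0D S0res) ph_refl ph_trans ph_chain.
suff pT k b : @ph_dom p k b.
  exists (ph_fun p) => b; apply/eqP; rewrite -subr_eq0; apply/eqP.
  exact: ph_res (pT 0 b).
apply: contrapT => pb; have [K [Kb Ku KA KD]] := finite_closure pb.
have [sigma [sK s0 s1]] := finite_null_homotopy Ku (@ph_domD p) KA KD
  (@ph_res p) (residualD _).
have sA j c : ph_dom p c -> sigma j c = 0 by move=> /(supported_A KA (sK j)).
pose S j (c : B j) := ph_dom p c \/ c \in K j.
(* On [K] the arbitrary values of [ph_fun p] are kept, and [sigma] cancels the residual that they
   leave. *)
pose s j c := ph_fun p c + sigma j c.
have SD j (a : B j) c : S j a -> D a c <> 0 -> S j.+1 c.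
  move=> [pa|Ka] Dac; first by left; exact: ph_domD pa Dac.
  exact: KD Ka Dac.
have resD j (a : B j) : residual s a = residual (@ph_fun p) a -
    match j return B j -> X j with 0 => fun a => wsum (D a) (sigma 0)
    | j.+1 => fun a => d (sigma j a) + wsum (D a) (sigma j.+1) end a.
  case: j a => [|j] a /=; rewrite wsumD; first by rewrite opprD addrA.
  by rewrite [d (s j a)]raddfD addrACA opprD addrA.
have Sres j (a : B j) : S j a -> residual s a = 0.
  case=> [pa|Ka].
    rewrite -(ph_res pa); apply: (@residual_local (@ph_dom p)) pa => [|i c pc].
      exact: ph_domD.
    by rewrite /s sA // addr0.
  by rewrite resD; case: j a Ka => [|j] a Ka; rewrite -?s0 -?s1 // subrr.
have /pmax/asboolP[] : ph_le p (PartialHomotopy SD Sres).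
  apply/asboolP; split=> j a pa /=; first by left.
  by rewrite /s sA // addr0.
by move=> /(_ k b) le_p _; apply: pb; apply: le_p; right.
Qed.

End NullHomotopy.

(** * Totally acyclic complexes *)

Section Projective.
Variables (R : comPzRingType) (P : lmodType R).

Lemma finite_supp_closed : finite_supp (0 : P -> R^o) /\
  forall c (a b : P -> R^o), finite_supp (R := R) a -> finite_supp (R := R) b ->
    finite_supp (R := R) (c *: a + b).
Proof. by split=> [|c a b]; [exists [::] | exact: finite_suppD]. Qed.

(** The free module on all elements of [P] surjects onto [P]; a section of this surjection provides
    the coordinates. *)
Lemma dual_basis : projective P -> exists coef : P -> P -> R,
  [/\ forall p, finite_supp (coef p),
      forall a p q c, coef (a *: p + q) c = a * coef p c + coef q c &
      forall p, wsum (coef p) id = p].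
Proof.
move=> Pproj; pose F := submodule_type (Submodule finite_supp_closed).
have Ffin (a : F) : finite_supp (R := R) (val a) by
    exact: (@submodule_valP _ _ (Submodule finite_supp_closed) a).
have valF c (a b : F) : val (c *: a + b) = c *: (val a : P -> R^o) + val b.
  exact: (linearP (val : {linear F -> (P -> R^o)})).
have evl : linear (fun a : F => wsum (R := R) (val a) id).
  by move=> c a b; rewrite valF; exact: wsum_linear.
have idl : linear (fun p : P => p) by [].
have [p|h hP] := Pproj F P (linear_pack evl) (linear_pack idl).
  exists (submodule_elt (S := Submodule finite_supp_closed) (finite_supp_unit R p)).
  exact: wsum_unit.
exists (fun p => val (h p)); split=> [p|a p q c|p]; first exact: Ffin.
  by rewrite linearP valF.
exact: hP.
Qed.

(** A relation holds coordinatewise in a dual basis, and only finitely many basis elements occur in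
    the [g i]. *)
Lemma projective_eqflat : projective P -> eqflat P.
Proof.
move=> /dual_basis[coef [cfin cl cP]] I a g ag0.
pose s := undup (flatten [seq fsupp (coef (g i)) | i <- enum I]).
exists 'I_(size s), (fun i j => coef (g i) (tnth (in_tuple s) j)),
  (tnth (in_tuple s)).
split=> [i|j].
  rewrite -[LHS]cP (wsum_seq (s := s)) ?undup_uniq //; first exact: big_tnth.
  move=> x xs; rewrite (fsuppP (cfin _)) ?scale0r //.
  apply: contra xs => xi; rewrite /s mem_undup; apply/flattenP.
  by exists (fsupp (coef (g i))) => //; apply/map_f; rewrite mem_enum.
set c := tnth _ _; have cl' : linear (coef^~ c : P -> R^o).
  by move=> r p q; rewrite cl.
have c0 : coef 0 c = 0 := raddf0 (linear_pack cl').
rewrite -[RHS]c0 -ag0; apply/esym.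
apply: etrans (raddf_sum (linear_pack cl') _ _ _) _.
by apply: eq_bigr => i _; rewrite /= -[a i *: g i]addr0 cl c0 addr0.
Qed.

End Projective.

(** [Y] is a retract of the free complex on all its elements, whose
    differential sends the basis element [b] to the coordinates of [delta b]
    in a dual basis. *)
Lemma projective_null_homotopy (R : comPzRingType) (X : pure_coresolution R)
    (Y : nat -> lmodType R) (delta : forall k, {linear Y k -> Y k.+1})
    (f : forall k, {linear Y k -> X k}) :
  (forall k, projective (Y k)) ->
  (forall k x, delta k.+1 (delta k x) = 0) ->
  (forall k x, pc_d X k (f k x) = f k.+1 (delta k x)) ->
  exists g : {linear Y 1 -> X 0}, forall x, g (delta 0 x) = f 0 x.
Proof.
move=> Yproj dd fd.
have /dep_choice[coef cP] k := dual_basis (Yproj k).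
have cfin k (p : Y k) : finite_supp (coef k p) by case: (cP k).
have cl (V : lmodType R) k (u : Y k -> V) : linear (fun p => wsum (coef k p) u).
  move=> a p q; have [_ cl _] := cP k; rewrite -wsum_linear //.
  by congr wsum; apply/funext => c.
have cE k (p : Y k) : wsum (coef k p) id = p by case: (cP k).
have cmap (V : lmodType R) k (u : {linear Y k -> V}) p : wsum (coef k p) u = u p.
  by rewrite -[RHS](congr1 u (cE k p)) wsum_map.
pose D k (b : Y k) := coef k.+1 (delta k b).
have DD (V : lmodType R) k (b : Y k) (s : Y k.+2 -> V) :
    wsum (D k b) (fun c => wsum (D k.+1 c) s) = 0.
  have ul : linear (fun c => wsum (D k.+1 c) s).
    by move=> a x y; rewrite /D linearP cl.
  rewrite (cmap _ _ (linear_pack ul)) /= /D dd.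
  exact: (raddf0 (linear_pack (cl _ _ s))).
have [k b|k b|s sP] := @null_homotopy R X (fun k => Y k) D _ DD f.
- exact: cfin.
- by rewrite fd cmap.
by exists (linear_pack (cl _ _ s)) => x; rewrite sP.
Qed.

Section TotallyAcyclic.
Variables (R : comPzRingType) (C : complex R).

(** Hom-tensor adjunction. *)
Lemma tensor_acyclic_Hom_dual (E I : lmodType R) : extends_maps E ->
  acyclic (tensor_complex I C) ->
  forall n (f : {linear C (n + 1) -> dual E I}),
    (forall x, f (cx_d C (n + 1) x) = 0) ->
    exists g : {linear C n -> dual E I}, forall x, g (cx_d C n x) = f x.
Proof.
move=> Eext IC n f fd.
have [||||phi [phiE _]] := @tensor_universal R I (C (n + 1)) E
  (fun i x => dual_fun (f x) i).
- by move=> i i' x; rewrite raddfD.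
- move=> i x x'; rewrite raddfD /=.
  by rewrite -[X in dual_fun (X + _)]scale1r dual_funP scale1r.
- by move=> a i x; rewrite linearZ.
- by move=> a i x; rewrite linearZ dual_funZ.
(* By acyclicity the kernel of the tensored differential consists of boundaries, and these are
   killed by [phi]. *)
have [x|psi psiE] := Eext _ _ (tensor_map (M := I) (cx_d C n) : {linear _ -> _}) phi.
  move/(IC n x).1 => [y <-]; elim/tensorW: y => s.
  rewrite tensor_piE !raddf_sum big1 // => -[i y] _ /=.
  by rewrite tensor_mapE phiE fd dual_fun0.
have pl x : linear (fun i => psi (tens i x)).
  by move=> a i i'; rewrite tensDl tensZl linearP.
have gl : linear (fun x => dual_pack (pl x)).
  move=> a x y; apply: dualP => i; rewrite dual_funP -[LHS]/(psi _).
  by rewrite tensDr tensZr linearP.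
exists (linear_pack gl) => x; apply: dualP => i; rewrite -[LHS]/(psi _).
by rewrite -tensor_mapE -phiE; exact: psiE.
Qed.

(** The differential between degrees that are consecutive by a proof rather than by conversion, as
    happens in [descending]. *)
Definition cx_cast (i j : int) (e : i = j + 1) : {linear C i -> C j} :=
  match esym e in _ = i return {linear C i -> C j} with erefl => cx_d C j end.

Lemma cx_castE n (e : n + 1 = n + 1) : cx_cast e = cx_d C n.
Proof. by rewrite (eq_axiomK e). Qed.

Lemma cx_cast_dd i j k (e : i = j + 1) (e' : j = k + 1) x :
  cx_cast e' (cx_cast e x) = 0.
Proof. by subst j; subst i; rewrite !cx_castE cx_dd. Qed.

Lemma tensor_acyclic_Hom_cast (E I : lmodType R) : extends_maps E ->
  acyclic (tensor_complex I C) ->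
  forall i j k (e : i = j + 1) (e' : j = k + 1) (f : {linear C j -> dual E I}),
    (forall x, f (cx_cast e x) = 0) ->
    exists g : {linear C k -> dual E I}, forall x, g (cx_cast e' x) = f x.
Proof.
move=> Eext IC i j k e e'; subst j; subst i => f; rewrite !cx_castE.
exact: tensor_acyclic_Hom_dual.
Qed.

Variable n : int.

(** The first three values are spelled out so that the degrees of the final
    statement are obtained by conversion, without transport. *)
Definition descending (k : nat) : int :=
  match k with 0 => n + 1 + 1 | 1 => n + 1 | 2 => n | k.+3 => n - k.+1%:Z end.

Lemma descendingS k : descending k = descending k.+1 + 1.
Proof.
case: k => [|[|[|k]]] //=; first by rewrite subrK.
by rewrite -(addn1 k.+1) PoszD opprD addrA subrK.
Qed.

End TotallyAcyclic.

Lemma coherent_Hom_acyclic (R : comPzRingType) (C : complex R) (Q : lmodType R) :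
  coherent_ring R -> (forall n, projective (C n)) ->
  (forall I : lmodType R, injective_module I -> acyclic (tensor_complex I C)) ->
  projective Q -> Hom_acyclic C Q.
Proof.
move=> Rcoh Cproj IC Qproj n f; split=> [fd|[g gE] x]; last first.
  by rewrite -gE cx_dd raddf0.
pose E : lmodType R := coind R.
have Eext : extends_maps E := @coind_extends_maps R.
have Ecog : cogenerator E := @coind_cogenerator R.
pose Z := cosyzygy E Q; pose X := bidual_coresolution Ecog Q.
have Zflat k : eqflat (Z k).
  elim: k => [|k IHk]; first exact: projective_eqflat.
  by apply: cobidual_eqflat => //; exact: bidual_eqflat.
pose Y k := C (descending n k).
pose delta k : {linear Y k -> Y k.+1} := cx_cast C (descendingS n k).
(* The data at stage k: a map from P_(n+1-k) to the k-th cosyzygy that kills boundaries, beginning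
   with [f]. *)
pose Phi k := {phi : {linear Y k.+1 -> Z k} | forall x, phi (delta k x) = 0}.
(* The target is the dual of [dual E (Z k)], which is injective because [Z k] is flat, so the
   adjunction applies. *)
have ext k (phi : Phi k) : {gamma : {linear Y k.+2 -> bidual E (Z k)} |
    forall x, gamma (delta k.+1 x) = to_bidual E (sval phi x)}.
  have el : linear (fun x => to_bidual E (sval phi x)).
    by move=> a x y; rewrite !linearP.
  apply: cid; apply: (@tensor_acyclic_Hom_cast R C E _ Eext _ _ _ _
    (descendingS n k) (descendingS n k.+1) (linear_pack el)).
    by apply: IC; apply: extends_maps_injective; exact: eqflat_dual_extends.
  by move=> x; have /= := svalP phi x => ->; rewrite raddf0.
have nextP k (phi : Phi k) x :
    (cobidual_pi E (Z k) \o sval (ext k phi)) (delta k.+1 x) = 0.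
  by rewrite /= (svalP (ext k phi)); apply/cobidual_pi_eq0; exists (sval phi x).
have phi0P x : f (delta 0 x) = 0 by rewrite /delta cx_castE fd.
pose phi := nat_rect Phi (exist _ f phi0P) (fun k phi => exist _ _ (nextP k phi)).
(* The shift is the truncation: [Y 0] enters only through the condition that [f] kills boundaries,
   and the chain map starts with [f] from [Y 1] to [Q]. *)
pose F k : {linear Y k.+1 -> X k} :=
  match k with 0 => f | k.+1 => sval (ext k (phi k)) end.
have [|k x|k x|g gE] := @projective_null_homotopy R X (fun k => Y k.+1)
    (fun k => delta k.+1) F.
- by move=> k; exact: Cproj.
- exact: cx_cast_dd.
- rewrite [RHS](svalP (ext k (phi k)) x).
  by case: k x.
exists g => x.
by have := gE x; rewrite /delta cx_castE.
Qed.

Theorem theorem3p9 (X : scheme) (P : sheaf_complex X) :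
  locally_coherent X ->
  (forall n : int, vector_bundle (P n)) ->
  F_totally_acyclic_sheaf P ->
  forall U : opens X, affine_open U ->
    totally_acyclic (sections_complex P U).
Proof.
move=> Xcoh Pvb [_ PF] U Uaff.
have Pproj n : projective (sections_complex P U n) by have [_] := Pvb n; exact.
have [_ Pac PI] := PF U Uaff; split=> // Q Qproj.
exact: coherent_Hom_acyclic (Xcoh U Uaff) Pproj PI Qproj.
Qed.
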